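(* Let $F\le F'\le\mathrm{Sym}(\Omega)$. Suppose $F$ is $2$-transitive, $e\in E(T)$ and $g,h\in G(F,F')$ are hyperbolic. Then $g\asymp h$ (in $G(F,F')$) if and only if there exist $p,q\in\mathbb{N}$ such that $\{\mathcal{N}_e(g^{-pn}h^{qn})\mid n\in\mathbb{N}\}$ is bounded.
   Context: $\mathbb{N}=\{1,2,\dots\}$, $\mathbb{N}_0=\mathbb{N}\cup\{0\}$. **Tree and groups.** $T$ is a locally finite regular (undirected, simple) tree with vertex set $V(T)$, edge set $E(T)\subset V(T)\times V(T)$ (each edge occurs as $(u,v)$ and as $(v,u)=\overline{(u,v)}$); $E(v)$ is the set of edges with origin $v$. $\Omega=\{0,\dots,\deg(T)-1\}$. Fix a legal colouring $c:E(T)\to\Omega$, i.e. $c(e)=c(\bar e)$ for all $e$ and $c|_{E(v)}:E(v)\to\Omega$ is a bijection for each $v$. For $g\in\mathrm{Aut}(T)$, $v\in V(T)$, the local action is $\sigma(g,v)=c\circ g\circ (c|_{E(v)})^{-1}\in\mathrm{Sym}(\Omega)$. For $F\le\mathrm{Sym}(\Omega)$, $U(F)=\{g\in\mathrm{Aut}(T):\sigma(g,v)\in F\ \forall v\in V(T)\}$ with the permutation topology. For $F\le F'\le\mathrm{Sym}(\Omega)$, $G(F,F')=\{g\in U(F'):\sigma(g,v)\in F\text{ for all but finitely many }v\}$, with the unique group topology making the inclusion $U(F)\to G(F,F')$ continuous and open; it is a totally disconnected locally compact (t.d.l.c.) group. The singularity set is $S(g)=\{v\in V(T):\sigma(g,v)\notin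 F\}$. $g\in\mathrm{Aut}(T)$ is elliptic if it preserves some non-empty finite set of vertices, otherwise hyperbolic. $F$ is $2$-transitive if for all pairs $(a,b),(c,d)\in\Omega^2$ of distinct elements some $f\in F$ has $(f(a),f(b))=(c,d)$. **The function $\mathcal{N}_e$.** A subtree $\mathcal{T}$ of $T$ is complete if every vertex $v$ of $\mathcal{T}$ either has all its $T$-neighbours in $\mathcal{T}$ or has valency $1$ in $\mathcal{T}$; $\mathrm{Int}(\mathcal{T})$ is the set of $v\in V(\mathcal T)$ with $E(v)\subset E(\mathcal{T})$. For $e\in E(T)$ and $g\in G(F,F')$, $\mathcal{T}_e(g)$ is the unique minimal complete subtree of $T$ such that $e$ and $g^{-1}(e)$ are edges of $\mathcal{T}_e(g)$ and $S(g)\subset\mathrm{Int}(\mathcal{T}_e(g))$. Set $\mathcal{N}_e(g)=|\mathrm{Int}(\mathcal{T}_e(g))|$. **Asymptotic relation.** For a t.d.l.c. group $G$, $\mathrm{COS}(G)$ is the set of compact open subgroups with metric $d(U,V)=\log([U:U\cap V][V:U\cap V])$. For $g,h\in G$, $g\asymp h$ ($g$ and $h$ are asymptotic) if there exist $k,l\in\mathbb{N}$ and $U,V\in\mathrm{COS}(G)$ such that $d(g^{kn}Ug^{-kn},h^{ln}Vh^{-ln})$ is bounded over $n\in\mathbb{N}_0$. This is an equivalence relation, independent of the choice of $U,V$.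
   Formalization: The degree of T is assumed to be at least 3; for degree 2 (T a line, F = F' = Sym(2)) the claim fails, since G(F,F') is discrete so all elements are asymptotic, while N_e is unbounded for translations in opposite directions; for degree at most 1 there are no hyperbolic elements. *)

(* Defs.v *)
From HB Require Import structures.
From mathcomp Require Import all_boot all_order all_algebra all_fingroup.
From mathcomp Require Import primitive_action.
From mathcomp Require Import finmap.
From mathcomp Require Import boolp classical_sets functions cardinality.
From mathcomp Require Import reals topology exp.

Set Implicit Arguments.
Unset Strict Implicit.
Unset Printing Implicit Defensive.

Import Order.TTheory GRing.Theory Num.Theory.

Local Open Scope classical_set_scope.
Local Open Scope group_scope.

HB.mixin Record isTopologicalGroup G of monoid.Group G & Topological G := {
  mulg_continuous : continuous (fun xy : G * G => xy.1 * xy.2);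
  invg_continuous : continuous (fun x : G => x^-1)
}.

#[short(type="topologicalGroupType")]
HB.structure Definition TopologicalGroup :=
  {G of isTopologicalGroup G & monoid.Group G & Topological G}.

Definition lcosets_of (G : groupType) (U W : set G) : set (set G) :=
  [set [set u * w | w in W] | u in U].

(* The index [U : W] of a subgroup W of U; only meaningful when it is finite,
   as it is for U in COS(G) and W = U `&` V with V in COS(G). *)
Definition index_of (G : groupType) (U W : set G) : nat :=
  (#|` fset_set (lcosets_of U W)|)%fset.

Definition conjugate (G : groupType) (g : G) (U : set G) : set G :=
  [set g * u * g^-1 | u in U].

Definition COS (G : topologicalGroupType) : set (set G) :=
  [set U | [/\ group_closed [in U], compact U & open U]].

Definition COS_dist (R : realType) (G : groupType) (U V : set G) : R :=
  ln ((index_of U (U `&` V))%:R * (index_of V (U `&` V))%:R)%R.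

Definition asymptotic (R : realType) (G : topologicalGroupType) (g h : G) :=
  exists k l : nat, (0 < k)%N /\ (0 < l)%N /\
  exists U V : set G, COS U /\ COS V /\
  exists M : R, forall n : nat,
    (COS_dist R (conjugate (g ^+ (k * n)) U) (conjugate (h ^+ (l * n)) V)
       <= M)%R.

Record regular_tree (d : nat) := RegularTree {
  vertex :> choiceType;
  adj : rel vertex;
  adj_sym : symmetric adj;
  adj_irr : irreflexive adj;
  tree_connected : forall u v, exists2 p, path adj u p & last u p = v;
  tree_acyclic : forall p, (2 < size p)%N -> ~ ucycle adj p;
  tree_regular : forall v, ([set w | adj v w] #= `I_d)%card
}.
Arguments adj {d r}.

Record edge d (T : regular_tree d) := Edge {
  origin : T;
  terminus : T;
  edge_adj : adj origin terminus
}.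

Definition edge_rev d (T : regular_tree d) (e : edge T) : edge T :=
  @Edge d T (terminus e) (origin e) (etrans (adj_sym _ _) (edge_adj e)).

Definition star d (T : regular_tree d) (v : T) : set (edge T) :=
  [set e | origin e = v].

Record legal_colouring d (T : regular_tree d) := LegalColouring {
  colour :> edge T -> 'I_d;
  colour_rev : forall e, colour (edge_rev e) = colour e;
  colour_bij : forall v, set_bij (star v) [set: 'I_d] colour
}.

Lemma edge_eq d (T : regular_tree d) (e e' : edge T) :
  origin e = origin e' -> terminus e = terminus e' -> e = e'.
Proof.
case: e e' => u v uv [u' v' uv'] /= uE vE; case: _ / uE uv' => uv'.
by case: _ / vE uv' => uv'; rewrite (bool_irrelevance uv uv').
Qed.

(* Automorphisms are multiplied by composition of functions, g * h = g \o h, and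
   carry the permutation topology. *)

Record aut d (T : regular_tree d) := Aut {
  aut_fun :> T -> T;
  aut_inv : T -> T;
  aut_funK : cancel aut_fun aut_inv;
  aut_invK : cancel aut_inv aut_fun;
  aut_adj : forall u v, adj (aut_fun u) (aut_fun v) = adj u v
}.

Section Automorphisms.
Context (d : nat) (T : regular_tree d).
Implicit Types g h : aut T.

HB.instance Definition _ := gen_eqMixin (aut T).
HB.instance Definition _ := gen_choiceMixin (aut T).

Lemma aut_eq g h : g =1 h -> g = h.
Proof.
case: g h => [f f' fK f'K fA] [k k' kK k'K kA] /= /funext fk.
move: fK f'K fA; rewrite fk => fK f'K fA.
have f'k' : f' = k' by apply/funext => x; rewrite -{1}(k'K x) fK.
by move: fK f'K; rewrite f'k' => fK f'K; congr Aut; exact: Prop_irrelevance.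
Qed.

Definition aut_one : aut T :=
  @Aut d T idfun idfun (fun=> erefl) (fun=> erefl) (fun _ _ => erefl).

Definition aut_mul g h : aut T :=
  @Aut d T (g \o h) (aut_inv h \o aut_inv g)
    (can_comp (aut_funK g) (aut_funK h)) (can_comp (aut_invK h) (aut_invK g))
    (fun u v => etrans (aut_adj g (h u) (h v)) (aut_adj h u v)).

Lemma aut_inv_adj g u v : adj (aut_inv g u) (aut_inv g v) = adj u v.
Proof. by rewrite -(aut_adj g) !aut_invK. Qed.

Definition aut_opp g : aut T :=
  @Aut d T (aut_inv g) g (aut_invK g) (aut_funK g) (aut_inv_adj g).

Lemma aut_mulA : associative aut_mul.
Proof. by move=> f g h; exact: aut_eq. Qed.
Lemma aut_mul1g : left_id aut_one aut_mul.
Proof. by move=> g; exact: aut_eq. Qed.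
Lemma aut_mulg1 : right_id aut_one aut_mul.
Proof. by move=> g; exact: aut_eq. Qed.
Lemma aut_mulVg : left_inverse aut_one aut_opp aut_mul.
Proof. by move=> g; apply: aut_eq => x /=; rewrite aut_funK. Qed.
Lemma aut_mulgV : right_inverse aut_one aut_opp aut_mul.
Proof. by move=> g; apply: aut_eq => x /=; rewrite aut_invK. Qed.

HB.instance Definition _ := isGroup.Build (aut T)
  aut_mulA aut_mul1g aut_mulg1 aut_mulVg aut_mulgV.

Definition aut_open : set_system (aut T) := [set O | forall g, O g ->
  exists2 A : set T, finite_set A & forall h, {in A, h =1 g} -> O h].

Lemma aut_openT : aut_open setT.
Proof. by move=> g _; exists set0. Qed.

Lemma aut_openI : setI_closed aut_open.
Proof.
move=> O P oO oP g [Og Pg]; have [A fA AO] := oO g Og.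
have [B fB BP] := oP g Pg; exists (A `|` B); first by rewrite finite_setU.
move=> h hg; split.
  by apply: AO => x /set_mem Ax; apply: hg; apply/mem_set; left.
by apply: BP => x /set_mem Bx; apply: hg; apply/mem_set; right.
Qed.

Lemma aut_open_bigU (I : Type) (f : I -> set (aut T)) :
  (forall i, aut_open (f i)) -> aut_open (\bigcup_i f i).
Proof.
move=> of_ g [i _ fig]; have [A fA Af] := of_ i g fig.
by exists A => // h hg; exists i => //; exact: Af.
Qed.

HB.instance Definition _ :=
  isOpenTopological.Build (aut T) aut_openT aut_openI aut_open_bigU.

Definition elliptic g := exists A : set T,
  [/\ finite_set A, A !=set0 & [set g v | v in A] = A].

Definition hyperbolic g := ~ elliptic g.

Definition aut_edge g (e : edge T) : edge T :=
  @Edge d T (g (origin e)) (g (terminus e))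
    (etrans (aut_adj g _ _) (edge_adj e)).

Lemma aut_edgeM g h e : aut_edge (g * h) e = aut_edge g (aut_edge h e).
Proof. exact: edge_eq. Qed.

Lemma aut_edge1 e : aut_edge 1 e = e.
Proof. exact: edge_eq. Qed.

Lemma aut_edge_inj g : injective (aut_edge g).
Proof.
by move=> e f ef; rewrite -(aut_edge1 e) -(mulVg g) aut_edgeM ef -aut_edgeM
  mulVg aut_edge1.
Qed.

End Automorphisms.

Section LocalAction.
Context (d : nat) (T : regular_tree d) (c : legal_colouring T).
Implicit Types (g h : aut T) (v : T) (i : 'I_d).

Lemma star_edge_ex v i : exists2 e, star v e & c e = i.
Proof. by have [_ _ /(_ i I)[e ? ?]] := colour_bij c v; exists e. Qed.

(* the inverse of the restriction of c to E(v) *)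
Definition star_edge v i : edge T := s2val (cid2 (star_edge_ex v i)).

Lemma star_star_edge v i : origin (star_edge v i) = v.
Proof. exact: s2valP (cid2 (star_edge_ex v i)). Qed.

Lemma star_edgeK v : cancel (star_edge v) c.
Proof. by move=> i; exact: s2valP' (cid2 (star_edge_ex v i)). Qed.

Lemma colour_inj e f : origin e = origin f -> c e = c f -> e = f.
Proof.
move=> oef cef; have [_ + _] := colour_bij c (origin f).
by apply => //; exact/mem_set.
Qed.

Lemma colourK e : star_edge (origin e) (c e) = e.
Proof. by apply: colour_inj; rewrite ?star_star_edge ?star_edgeK. Qed.

Definition local_fun g v i : 'I_d := c (aut_edge g (star_edge v i)).

Lemma local_fun_inj g v : injective (local_fun g v).
Proof.
move=> i j /colour_inj; rewrite /= !star_star_edge => /(_ erefl).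
by move=> /aut_edge_inj ij; rewrite -(star_edgeK v i) ij star_edgeK.
Qed.

Definition local_action g v : {perm 'I_d} := perm (@local_fun_inj g v).

Lemma local_actionE g e : local_action g (origin e) (c e) = c (aut_edge g e).
Proof. by rewrite permE /local_fun colourK. Qed.

(* Products in {perm 'I_d} are composed from left to right. *)
Lemma local_actionM g h v :
  local_action (g * h) v = local_action h v * local_action g (h v).
Proof.
apply/permP => i; rewrite permM.
have := local_actionE g (aut_edge h (star_edge v i)).
rewrite /= star_star_edge -aut_edgeM => E.
by rewrite [local_action h v i]permE /local_fun E permE.
Qed.

Lemma local_action1 v : local_action 1 v = 1.
Proof.
by apply/permP => i; rewrite perm1 permE /local_fun aut_edge1 star_edgeK.
Qed.

Lemma local_actionV g v :
  local_action g^-1 v = (local_action g (g^-1 v))^-1.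
Proof.
apply/eqP; rewrite eq_sym -(can_eq (mulgK (local_action g (g^-1 v)))) mulVg.
by rewrite -local_actionM mulgV local_action1.
Qed.

Definition burger_mozes (F : {set {perm 'I_d}}) : set (aut T) :=
  [set g | forall v, local_action g v \in F].

Definition singularities (F : {set {perm 'I_d}}) (g : aut T) : set T :=
  [set v | local_action g v \notin F].

Definition le_boudec_set (F F' : {set {perm 'I_d}}) : set (aut T) :=
  [set g | burger_mozes F' g /\ finite_set (singularities F g)].

End LocalAction.

(* G(F,F'). It is not declared as a set_type, because that would give it the
   subspace topology of Aut(T). *)
Record le_boudec d (T : regular_tree d) (c : legal_colouring T)
    (F F' : {group {perm 'I_d}}) := LeBoudec {
  le_boudec_aut :> aut T;
  _ : le_boudec_aut \in le_boudec_set c F F'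
}.

Section LeBoudecGroup.
Context (d : nat) (T : regular_tree d) (c : legal_colouring T).
Context (F F' : {group {perm 'I_d}}).
Local Notation G := (le_boudec c F F').

HB.instance Definition _ := [isSub for @le_boudec_aut d T c F F'].
HB.instance Definition _ := [Choice of G by <:].

Lemma le_boudec_group_closed : group_closed [in le_boudec_set c F F'].
Proof.
split.
  apply/mem_set; split=> [v|]; first by rewrite local_action1 group1.
  apply: (@sub_finite_set _ _ set0) => // v /=.
  by rewrite /singularities /= local_action1 group1.
move=> g h /set_mem[gF' fg] /set_mem[hF' fh]; apply/mem_set; split=> [v|].
  by rewrite local_actionM local_actionV groupM ?groupV ?gF' ?hF'.
apply: (@sub_finite_set _ _
  ([set h v | v in singularities c F h] `|`
   [set h v | v in singularities c F g])).
  move=> v; rewrite /singularities /= => nF.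
  have hK : h (h^-1 v) = v by exact: aut_invK.
  have [hF|hF] := boolP (local_action c h (h^-1 v) \in F); last first.
    by left; exists (h^-1 v).
  right; exists (h^-1 v) => //=; apply: contra nF => gF.
  by rewrite local_actionM local_actionV groupM ?groupV.
by rewrite finite_setU; split; exact: finite_image.
Qed.

HB.instance Definition _ :=
  SubChoice_isSubGroup.Build _ _ G le_boudec_group_closed.

(* A basis of neighbourhoods of g consists of the sets g U(F)_A where A is a
   finite set of vertices and U(F)_A its pointwise stabiliser in U(F). *)
Definition le_boudec_open : set_system G := [set O | forall g, O g ->
  exists2 A : set T, finite_set A &
    forall u : G, burger_mozes c F u -> {in A, u =1 id} -> O (g * u)].

Lemma le_boudec_openT : le_boudec_open setT.
Proof. by move=> g _; exists set0. Qed.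

Lemma le_boudec_openI : setI_closed le_boudec_open.
Proof.
move=> O P oO oP g [Og Pg]; have [A fA AO] := oO g Og.
have [B fB BP] := oP g Pg; exists (A `|` B); first by rewrite finite_setU.
move=> u uF u1; split.
  by apply: AO => // x /set_mem Ax; apply: u1; apply/mem_set; left.
by apply: BP => // x /set_mem Bx; apply: u1; apply/mem_set; right.
Qed.

Lemma le_boudec_open_bigU (I : Type) (f : I -> set G) :
  (forall i, le_boudec_open (f i)) -> le_boudec_open (\bigcup_i f i).
Proof.
move=> of_ g [i _ fig]; have [A fA Af] := of_ i g fig.
by exists A => // u uF u1; exists i => //; exact: Af.
Qed.

HB.instance Definition _ := isOpenTopological.Build G
  le_boudec_openT le_boudec_openI le_boudec_open_bigU.

Definition fixator (A : set T) : set G :=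
  [set u | burger_mozes c F u /\ {in A, u =1 id}].

Lemma burger_mozesM (g h : aut T) :
  burger_mozes c F g -> burger_mozes c F h -> burger_mozes c F (g * h).
Proof.
by move=> gF hF v; rewrite local_actionM groupM; [|exact: hF|exact: gF].
Qed.

Lemma burger_mozesV (g : aut T) :
  burger_mozes c F g -> burger_mozes c F g^-1.
Proof. by move=> gF v; rewrite local_actionV groupV; exact: gF. Qed.

Lemma fixator1 A : fixator A 1.
Proof. by split=> [v|//]; rewrite /= local_action1 group1. Qed.

Lemma fixatorM A x y : fixator A x -> fixator A y -> fixator A (x * y).
Proof.
move=> [xF xA] [yF yA]; split; first exact: burger_mozesM.
by move=> v vA /=; rewrite yA ?xA.
Qed.

Lemma fixatorV A x : fixator A x -> fixator A x^-1.
Proof.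
move=> [xF xA]; split; first exact: burger_mozesV.
by move=> v vA /=; rewrite -[in LHS](xA v vA) aut_funK.
Qed.

Lemma le_boudec_nbhsP (g : G) (A : set G) : nbhs g A <->
  exists2 B : set T, finite_set B & forall u, fixator B u -> A (g * u).
Proof.
rewrite nbhsE; split=> [[O [oO Og] OA]|[B fB BA]].
  have [B fB BO] := oO g Og; exists B => // u [uF uB].
  exact/OA/BO.
exists [set g * u | u in fixator B]; last by move=> _ [u uB <-]; exact: BA.
split; last by exists 1; [exact: fixator1|rewrite mulg1].
move=> _ [u uB <-]; exists B => // w wF wB; exists (u * w); last exact: mulgA.
by apply: fixatorM.
Qed.

Lemma local_action_fix (x : aut T) v : x v = v ->
  (forall w, adj v w -> x w = w) -> local_action c x v = 1.
Proof.
move=> xv xw; apply/permP => i; rewrite perm1 permE /local_fun.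
set e := star_edge c v i; have oe : origin e = v by exact: star_star_edge.
rewrite (_ : aut_edge x e = e) ?star_edgeK//; apply: edge_eq => /=.
  by rewrite oe.
by apply: xw; rewrite -oe; exact: edge_adj.
Qed.

Lemma finite_neighbours (v : T) : finite_set [set w | adj v w].
Proof. by exists d; exact: tree_regular. Qed.

Lemma fixator_conj (h : G) (B : set T) : finite_set B ->
  exists2 C : set T, finite_set C &
    forall x, fixator C x -> fixator B (h^-1 * x * h).
Proof.
move=> fB; have [hF' fS] := set_mem (valP h).
pose N := \bigcup_(v in singularities c F h) [set w | adj v w].
exists [set h v | v in B `|` (singularities c F h `|` N)].
  apply: finite_image; rewrite !finite_setU; split=> //; split=> //.
  by apply: bigcup_finite => // v _; exact: finite_neighbours.
move=> x [xF xC]; split=> [v|v vB] /=; last first.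
  rewrite xC; last by apply/mem_set; exists v => //; left; exact: set_mem.
  by rewrite aut_funK.
have fixS w : singularities c F h w -> x (h w) = h w.
  by move=> wS; apply: xC; apply/mem_set; exists w => //; right; left.
have hK w : h (h^-1 w) = w by exact: (aut_invK (val h)).
have [hv|hv] := boolP (local_action c h v \in F).
  have [hw|/fixS] := boolP (local_action c h (h^-1 (x (h v))) \in F).
    by rewrite !local_actionM local_actionV !groupM ?groupV //; exact: xF.
  rewrite hK => xx; have {xx} xv : x (h v) = h v.
    exact: (can_inj (aut_funK (val x))).
  rewrite !local_actionM local_actionV /= xv.
  by rewrite aut_funK !groupM ?groupV //; exact: xF.
rewrite !local_actionM local_actionV /= (fixS _ hv) aut_funK.
rewrite (local_action_fix (fixS _ hv)) ?mul1g ?mulgV ?group1 //.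
move=> w hvw; rewrite -[w](aut_invK h); apply: xC; apply/mem_set.
exists (aut_inv h w) => //; right; right; exists v => //=.
by rewrite -(aut_adj h) aut_invK.
Qed.

Lemma le_boudec_mulg_continuous : continuous (fun xy : G * G => xy.1 * xy.2).
Proof.
move=> [g h] A /le_boudec_nbhsP[B fB BA].
have [C fC CB] := fixator_conj h fB.
exists ([set g * x | x in fixator C], [set h * u | u in fixator B]).
  by split; apply/le_boudec_nbhsP; [exists C|exists B] => // u ?; exists u.
move=> [a b] [/= [x xC <-] [u uB <-]].
rewrite (_ : _ * _ = g * h * (h^-1 * x * h * u)).
  by apply: BA; apply: fixatorM => //; exact: CB.
by rewrite !mulgA mulgK.
Qed.

Lemma le_boudec_invg_continuous : continuous (fun x : G => x^-1).
Proof.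
move=> g A /le_boudec_nbhsP[B fB BA].
have [C fC CB] := fixator_conj g^-1 fB.
apply/le_boudec_nbhsP; exists C => // u uC /=.
rewrite (_ : (g * u)^-1 = g^-1 * (g^-1^-1 * u^-1 * g^-1)).
  by apply: BA; apply: CB; exact: fixatorV.
by rewrite invgK invgM !mulgA mulVg mul1g.
Qed.

HB.instance Definition _ := isTopologicalGroup.Build G
  le_boudec_mulg_continuous le_boudec_invg_continuous.

(* The topology of G(F,F') is the unique one for which left translations are
   continuous and the inclusion of U(F) is continuous and open. *)
Section Inclusion.
Hypothesis FF' : F \subset F'.

Lemma burger_mozes_le_boudec (u : burger_mozes c F) :
  val u \in le_boudec_set c F F'.
Proof.
have uF := set_mem (valP u); apply/mem_set; split=> [v|].
  exact: (fintype.subsetP FF' _ (uF v)).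
apply: (@sub_finite_set _ _ set0) => // v.
by rewrite /singularities /= uF.
Qed.

Definition incl (u : burger_mozes c F) : G :=
  LeBoudec (burger_mozes_le_boudec u).

Lemma inclP (x : G) : burger_mozes c F x -> exists u, incl u = x.
Proof.
by move=> xF; exists (SigSub (mem_set xF)); exact: val_inj.
Qed.

Lemma incl_continuous : continuous incl.
Proof.
apply/continuousP => O oO.
exists [set h : aut T | exists2 A : set T, finite_set A &
    forall u, {in A, incl u =1 h} -> O (incl u)].
  move=> h [A fA AO]; exists A => // k kh; exists A => // u uk.
  by apply: AO => x xA; rewrite uk ?kh.
apply/seteqP; split=> u /=; first by case=> A _; exact.
move=> /oO[A fA AO]; exists A => // w wu.
have uF := set_mem (valP u); have wF := set_mem (valP w).
rewrite -(mulKVg (incl u) (incl w)); apply: AO.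
  exact: (burger_mozesM (burger_mozesV uF) wF).
by move=> v vA /=; rewrite wu //; exact: aut_funK.
Qed.

Lemma incl_open (W : set (burger_mozes c F)) : open W -> open (incl @` W).
Proof.
move=> [W' oW' <-]; suff: le_boudec_open (incl @` (set_val @^-1` W')) by [].
move=> _ [u /= uW' <-]; have [A fA AW'] := oW' _ uW'.
exists A => // w wF wA; have uF := set_mem (valP u).
have [x xE] := inclP (x := incl u * w) (burger_mozesM uF wF).
exists x => //=; apply: AW' => v vA.
have -> : set_val x = val (incl x) by [].
by rewrite xE /= wA.
Qed.

Lemma le_boudec_topology_unique (op : set_system G) :
    (forall (I : Type) (f : I -> set G),
      (forall i, op (f i)) -> op (\bigcup_i f i)) ->
    (forall (g : G) O, op O -> op [set u | O (g * u)]) ->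
    (forall O, op O -> open (incl @^-1` O)) ->
    (forall W, open W -> op (incl @` W)) ->
  op = open.
Proof.
move=> opU opT incl_cont incl_op; apply/seteqP; split=> O oO.
  suff: le_boudec_open O by [].
  move=> g Og; have /incl_open o1 := incl_cont _ (opT g _ oO).
  have [u1 u1E] := inclP (x := 1) (fixator1 set0).1.
  have [|A fA AO] := o1 1; first by exists u1 => //=; rewrite u1E mulg1.
  exists A => // u uF uA; have := AO u uF uA; rewrite mul1g.
  by move=> [w /= + <-].
have oT (g : G) : open [set u | O (g * u)].
  suff: le_boudec_open [set u | O (g * u)] by [].
  move=> u /oO[A fA AO]; exists A => // w wF wA.
  by rewrite /= mulgA; exact: AO.
pose W g := [set u | (incl @` (incl @^-1` [set u | O (g * u)])) (g^-1 * u)].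
have opW g : op (W g).
  apply: opT; apply: incl_op.
  by have /continuousP := incl_continuous; exact.
rewrite (_ : O = \bigcup_(g : {g | O g}) W (sval g)); first exact: opU.
apply/seteqP; split=> [g Og|x [[g Og] _ [u /= + uE]]].
  exists (exist _ g Og) => //; rewrite /W /= mulVg.
  have [u1 u1E] := inclP (x := 1) (fixator1 set0).1.
  by exists u1 => //=; rewrite u1E mulg1.
by rewrite uE mulKVg.
Qed.

End Inclusion.

End LeBoudecGroup.

(* A subtree of T is the induced subgraph on its vertex set, and is represented
   by that set. *)
Section Subtrees.
Context (d : nat) (T : regular_tree d).
Implicit Types S : set T.

Definition neighbours (v : T) : set T := [set w | adj v w].

Definition subtree S := S !=set0 /\ forall u v, S u -> S v ->
  exists p, [/\ path adj u p, last u p = v & {in p, forall w, S w}].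

Definition complete_subtree S := subtree S /\ forall v, S v ->
  neighbours v `<=` S \/ exists w, S `&` neighbours v = [set w].

Definition edge_of S (e : edge T) := S (origin e) /\ S (terminus e).

Definition Int S : set T := [set v | S v /\ neighbours v `<=` S].

End Subtrees.

Section MinimalSubtree.
Context (d : nat) (T : regular_tree d) (c : legal_colouring T).
Context (F F' : {group {perm 'I_d}}) (e : edge T) (g : le_boudec c F F').

Definition Te_spec : set (set T) :=
  [set S | [/\ complete_subtree S, edge_of S e,
               edge_of S (aut_edge (le_boudec_aut g)^-1 e) &
               singularities c F g `<=` Int S]].

Definition minimal_in (C : set (set T)) : set (set T) :=
  [set S | C S /\ forall S', C S' -> S' `<=` S -> S' = S].

(* For g in G(F,F') the minimal element of Te_spec exists, is unique and is
   finite, so the default values of xget and fset_set are not used. *)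
Definition Te : set T := xget set0 (minimal_in Te_spec).

Definition Ne : nat := (#|` fset_set (Int Te)|)%fset.

End MinimalSubtree.

(* Main.v *)
Require Import Defs.
From mathcomp Require Import all_boot all_order all_algebra all_fingroup.
From mathcomp Require Import primitive_action.
From mathcomp Require Import boolp classical_sets reals topology.
From HB Require Import structures.
From mathcomp Require Import finmap cardinality sequences exp.
From mathcomp Require Import zify.

(** Let U = U(F)_e be the pointwise stabiliser of e in U(F), a compact open
    subgroup. Replacing the two subgroups in the definition of asymptoticity by U
    changes distances by bounded amounts, so g and h are asymptotic if and only if,
    for some p and q, the indices of the intersection of U and x^-1 U x in both
    groups are bounded for the elements x = g^-(pn) h^(qn).

    These indices are at most |Sym(Omega)|^N, where N = N_e(x). Indeed, the hull
    T_e(x) contains e, x^-1 e and, in its interior, the singularities of x. Thus an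
    element fixing it pointwise belongs to U if and only if it belongs to x^-1 U x,
    and elements of one of these groups coincide on the hull as soon as they have
    the same local actions on its interior (index_le_hull).

    Conversely, suppose that the intersection of U and x^-1 U x has index at most K in U.
    As F is 2-transitive and there are at least three colours, the orbit under U of
    a vertex at distance n from e has at least 2^(n-1) elements
    (edge_group_orbit). The intersection of U and x^-1 U x fixes x^-1 e, so x^-1 e
    is within a bounded distance of e. This intersection also preserves the set
    S(x) of singularities. So, if S(x) has an element at distance n, it has at
    least 2^(n-1) / K of them. For a general x this is no contradiction, but if
    x = g^-P h^Q, then every element of S(x) is carried into the finite set S(h) by
    a power of h, or, after an application of x, into S(g) by a power of g. A
    hyperbolic automorphism moves points linearly fast
    (hyperbolic_displacement), so only O(n) of these elements can lie at distance
    n. Hence S(x) lies in a ball of bounded radius (singularities_bounded). A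
    slightly larger ball is a complete subtree of the kind that defines T_e(x), and
    contains T_e(x) because such subtrees are stable under intersection; this
    bounds N_e(x) (Ne_le_ball).

    Vertices are handled through the words of colours read along geodesics from a
    base vertex: T becomes the tree of words without equal adjacent letters, and
    automorphisms act on words through their local actions. *)

Set Implicit Arguments.
Unset Strict Implicit.
Unset Printing Implicit Defensive.

Import Defs Order.TTheory GRing.Theory Num.Theory.

Local Open Scope classical_set_scope.
Local Open Scope group_scope.

(** * Vertices as reduced words of colours *)

Section Words.
Context (d : nat) (T : regular_tree d) (c : legal_colouring T).
Implicit Types (u v w : T) (i j : 'I_d) (s : seq 'I_d) (g : aut T).

Definition nbr v i : T := terminus (star_edge c v i).

Lemma nbr_adj v i : adj v (nbr v i).
Proof. by rewrite -[v in adj v](star_star_edge c v i); exact: edge_adj. Qed.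

Lemma star_edge_rev v i :
  edge_rev (star_edge c v i) = star_edge c (nbr v i) i.
Proof.
apply: (@colour_inj d T c) => /=; first by rewrite star_star_edge.
by rewrite colour_rev !star_edgeK.
Qed.

Lemma nbrK v i : nbr (nbr v i) i = v.
Proof. by rewrite {1}/nbr -star_edge_rev /= star_star_edge. Qed.

Lemma nbr_inj v : injective (nbr v).
Proof.
move=> i j ij; rewrite -(star_edgeK c v i) -(star_edgeK c v j); congr (c _).
by apply: edge_eq; rewrite ?star_star_edge.
Qed.

Lemma nbr_terminus (e : edge T) : nbr (origin e) (c e) = terminus e.
Proof. by rewrite /nbr colourK. Qed.

Lemma adj_nbr v w : adj v w -> exists i, w = nbr v i.
Proof. by move=> vw; exists (c (Edge vw)); rewrite (nbr_terminus (Edge vw)). Qed.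

Lemma aut_nbr g v i : g (nbr v i) = nbr (g v) (local_action c g v i).
Proof.
have := nbr_terminus (aut_edge g (star_edge c v i)).
by rewrite -local_actionE star_edgeK /= !star_star_edge => <-.
Qed.

(** An edge and its image under g each have one colour, seen from either end. *)
Lemma local_action_nbr g v i :
  local_action c g (nbr v i) i = local_action c g v i.
Proof.
apply: (@nbr_inj (g (nbr v i))); rewrite -aut_nbr nbrK aut_nbr.
by rewrite nbrK.
Qed.

Definition walk v s := foldl nbr v s.

Lemma walk_cat v s1 s2 : walk v (s1 ++ s2) = walk (walk v s1) s2.
Proof. exact: foldl_cat. Qed.

Lemma walk_rcons v s i : walk v (rcons s i) = nbr (walk v s) i.
Proof. by rewrite -cats1 walk_cat. Qed.

Lemma walk_rev v s : walk (walk v s) (rev s) = v.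
Proof.
by elim: s v => //= i s IH v; rewrite rev_cons walk_rcons IH nbrK.
Qed.

Lemma walk_path v s : path adj v (scanl nbr v s).
Proof. by elim: s v => //= i s IH v; rewrite nbr_adj IH. Qed.

Lemma last_scanl v s : last v (scanl nbr v s) = walk v s.
Proof. by elim: s v => //= i s IH v; rewrite IH. Qed.

Definition reduced s := sorted (fun i j => i != j) s.

Lemma reduced_rcons_cat s i s' : reduced (rcons s i ++ s') =
  reduced (rcons s i) && path (fun i j => i != j) i s'.
Proof.
by rewrite /reduced; case: s => [|j s] //=; rewrite cat_path last_rcons.
Qed.

Lemma reduced_rcons2 s i j :
  reduced (rcons (rcons s i) j) = reduced (rcons s i) && (i != j).
Proof. by rewrite -[rcons _ j]cats1 reduced_rcons_cat /= andbT. Qed.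

Lemma reduced_rconsW s i : reduced (rcons s i) -> reduced s.
Proof. by rewrite /reduced -cats1 => /cat_sorted2[]. Qed.

Lemma reduced_rev s : reduced (rev s) = reduced s.
Proof. by rewrite /reduced rev_sorted; apply: eq_sorted => i j; rewrite eq_sym. Qed.

(** A closed reduced word of minimal positive length would trace an embedded
    circuit: a repeated vertex cuts off a shorter closed subword. *)
Lemma reduced_closed v s : reduced s -> walk v s = v -> s = [::].
Proof.
have [n] := ubnP (size s); elim: n v s => // n IH v s sn rs vs.
have [//|s0] := eqVneq s [::].
have s2 : (2 < size s)%N.
  case: s s0 rs vs {sn} => [|i [|j [|k s]]] //= _ rs vs.
    by have := nbr_adj v i; rewrite vs adj_irr.
  move: rs; rewrite andbT => /eqP[]; apply: (@nbr_inj (nbr v i)).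
  by rewrite vs nbrK.
exfalso; apply: (@tree_acyclic d T (scanl nbr v s)); first by rewrite size_scanl.
apply/andP; split.
  by rewrite (cycle_path v) last_scanl vs walk_path.
apply/negP => /negP/(uniqPn v)[i [j []]]; rewrite size_scanl => ij js.
rewrite !nth_scanl ?(ltn_trans ij) // => E.
have jE : take j.+1 s = take i.+1 s ++ drop i.+1 (take j.+1 s).
  by rewrite -[LHS](cat_take_drop i.+1) take_takel // ltnW.
have sz : size (drop i.+1 (take j.+1 s)) = (j - i)%N.
  by rewrite size_drop size_takel.
have /(congr1 size)/eqP : drop i.+1 (take j.+1 s) = [::].
  apply: (IH (walk v (take i.+1 s))).
  - by rewrite sz; apply: leq_trans (leq_ltn_trans (leq_subr _ _) js) _.

  - exact/drop_sorted/take_sorted.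
  - by rewrite -walk_cat -jE.
by rewrite sz subn_eq0 leqNgt ij.
Qed.

Lemma reduced_walk_inj v s1 s2 : reduced s1 -> reduced s2 ->
  walk v s1 = walk v s2 -> s1 = s2.
Proof.
elim: s1 s2 v => [|i s1 IH] [|j s2] v // r1 r2 E.
- by rewrite (reduced_closed r2 (esym E)).
- by rewrite (reduced_closed r1 E).
have [ij|ij] := eqVneq i j.
  rewrite -ij in E *; rewrite (IH s2 (nbr v i)) //.
  + exact: path_sorted r1.
  + exact: path_sorted r2.
suff: rev (i :: s1) ++ j :: s2 = [::].
  by move/(congr1 size); rewrite size_cat /= addnS.
apply: (@reduced_closed (walk v (i :: s1))).
  rewrite rev_cons reduced_rcons_cat -rev_cons reduced_rev r1 /= ij.
  exact: r2.
by rewrite walk_cat walk_rev -E.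
Qed.

(** The last clause says that the reduced word visits no new vertex; it gives the
    convexity of subtrees. *)
Lemma reduce_rcons s i : reduced s -> exists s',
  [/\ reduced s', (size s' <= (size s).+1)%N,
      forall v, walk v s' = nbr (walk v s) i &
      forall (S : T -> Prop) v, (forall k, S (walk v (take k s))) ->
        S (nbr (walk v s) i) -> forall k, S (walk v (take k s'))].
Proof.
elim/last_ind: s => [|s j _] rs.
  exists [:: i]; split=> // S v S0 Si [|k] //=; exact: (S0 0%N).
have [ij|ij] := eqVneq j i.
  exists s; split=> //.
  - exact: reduced_rconsW rs.
  - by rewrite size_rcons ltnW.
  - by move=> v; rewrite walk_rcons ij nbrK.
  move=> S v S0 _ k; have [ks|ks] := leqP k (size s).
    by have := S0 k; rewrite -cats1 takel_cat.
  by have := S0 (size s); rewrite -cats1 takel_cat // take_size take_oversize // ltnW.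
exists (rcons (rcons s j) i); split.
- by rewrite reduced_rcons2 rs.
- by rewrite !size_rcons.
- by move=> v; rewrite walk_rcons.
move=> S v S0 Si k; have [ks|ks] := leqP k (size (rcons s j)).
  by have := S0 k; rewrite -[rcons _ i]cats1 takel_cat.
by rewrite take_oversize; [rewrite walk_rcons|rewrite size_rcons].
Qed.

Lemma reduce s : exists s', [/\ reduced s', (size s' <= size s)%N &
  forall v, walk v s' = walk v s].
Proof.
elim/last_ind: s => [|s i [s' [rs' ss' ws']]]; first by exists [::].
have [t [rt st wt _]] := reduce_rcons i rs'; exists t; split=> //.
  by rewrite size_rcons (leq_trans st).
by move=> v; rewrite wt ws' walk_rcons.
Qed.

(** Cancelling backtracking in a path visits no new vertex, so the geodesic stays
    in every vertex set S in which its ends can be joined. *)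
Lemma path_reduced v p : path adj v p -> exists s,
  [/\ reduced s, (size s <= size p)%N, walk v s = last v p &
      forall S : T -> Prop, S v -> (forall w, w \in p -> S w) ->
        forall k, S (walk v (take k s))].
Proof.
elim/last_ind: p => [|p w IH]; first by exists [::].
rewrite rcons_path last_rcons => /andP[/IH[s [rs sp ws Ss]]] /adj_nbr[i ->].
have [t [rt st wt St]] := reduce_rcons i rs; exists t; split=> //.
- by rewrite size_rcons (leq_trans st).
- by rewrite wt ws.
move=> S Sv Sp; apply: St.
  by apply: Ss => // x xp; apply: Sp; rewrite mem_rcons inE xp orbT.
by apply: Sp; rewrite mem_rcons ws inE eqxx.
Qed.

Lemma word_ex u v : exists s, reduced s /\ walk u s = v.
Proof.
have [p pp <-] := tree_connected u v.
by have [s [? _ ? _]] := path_reduced pp; exists s.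
Qed.

(** The colours read along the geodesic from u to v; for fixed u this identifies
    the vertices with the reduced words. *)
Definition word u v : seq 'I_d := sval (cid (word_ex u v)).

Lemma word_reduced u v : reduced (word u v).
Proof. by rewrite /word; case: cid => s []. Qed.

Lemma wordK u v : walk u (word u v) = v.
Proof. by rewrite /word; case: cid => s []. Qed.

Lemma walkK v s : reduced s -> word v (walk v s) = s.
Proof.
move=> rs; apply: (@reduced_walk_inj v) => //; first exact: word_reduced.
exact: wordK.
Qed.

Lemma word_id v : word v v = [::].
Proof. exact: (@walkK v [::]). Qed.

Definition dist u v := size (word u v).

Lemma dist_walk v s : (dist v (walk v s) <= size s)%N.
Proof. by have [t [rt ? <-]] := reduce s; rewrite /dist walkK. Qed.

Lemma dist_reduced v s : reduced s -> dist v (walk v s) = size s.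
Proof. by move=> rs; rewrite /dist walkK. Qed.

Lemma dist_id v : dist v v = 0%N.
Proof. by rewrite /dist word_id. Qed.

Lemma dist0 u v : dist u v = 0%N -> u = v.
Proof. by move/size0nil => uv; rewrite -(wordK u v) uv. Qed.

Lemma dist_sym u v : dist u v = dist v u.
Proof.
suff le x y : (dist x y <= dist y x)%N by apply/eqP; rewrite eqn_leq !le.
rewrite -{1}(walk_rev y (word y x)) wordK.
by apply: leq_trans (dist_walk _ _) _; rewrite size_rev.
Qed.

Lemma dist_triangle v u w : (dist u w <= dist u v + dist v w)%N.
Proof.
rewrite -{1}(wordK v w) -{1}(wordK u v) -walk_cat.
by apply: leq_trans (dist_walk _ _) _; rewrite size_cat.
Qed.

Lemma dist_adj u v : adj u v -> (dist u v <= 1)%N.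
Proof. by move=> /adj_nbr[i ->]; exact: (dist_walk u [:: i]). Qed.

(** If s leads from v to w, this word leads from g v to g w. *)
Fixpoint act_word g v s : seq 'I_d :=
  if s is i :: s' then local_action c g v i :: act_word g (nbr v i) s' else [::].

Lemma walk_act_word g v s : walk (g v) (act_word g v s) = g (walk v s).
Proof. by elim: s v => //= i s IH v; rewrite -aut_nbr IH. Qed.

Lemma size_act_word g v s : size (act_word g v s) = size s.
Proof. by elim: s v => //= i s IH v; rewrite IH. Qed.

Lemma reduced_act_word g v s : reduced s -> reduced (act_word g v s).
Proof.
elim: s v => [|i [|j s] IH] v //= /andP[ij rs].
rewrite -(local_action_nbr g v i) (inj_eq perm_inj) ij.
exact: (IH (nbr v i) rs).
Qed.

Lemma dist_aut g u v : dist (g u) (g v) = dist u v.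
Proof.
rewrite -{1}(wordK u v) -walk_act_word dist_reduced ?size_act_word //.
exact/reduced_act_word/word_reduced.
Qed.

Definition vball v n : set T := [set w | (dist v w <= n)%N].

Lemma vball_finite v n : finite_set (vball v n).
Proof.
elim: n => [|n IH].
  by apply: (@sub_finite_set _ _ [set v]) => // w /=; rewrite /vball /= leqn0 => /eqP/dist0.
apply: (@sub_finite_set _ _ (vball v n `|` \bigcup_(w in vball v n) [set u | adj w u])).
  move=> w; rewrite /vball /=; have := wordK v w; have := word_reduced v w.
  rewrite /dist; case/lastP: (word v w) => [|s i] rs <- sn; first by left.
  rewrite size_rcons ltnS in sn.
  have vs : (dist v (walk v s) <= n)%N by apply: leq_trans (dist_walk _ _) sn.
  by right; exists (walk v s) => //; rewrite walk_rcons; exact: nbr_adj.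
rewrite finite_setU; split=> //; apply: bigcup_finite => // w _.
exact: finite_neighbours.
Qed.

End Words.

(** * The hull of the singularities *)

Section HullOfSingularities.
Context (d : nat) (T : regular_tree d) (c : legal_colouring T).
Context (F F' : {group {perm 'I_d}}).
Implicit Types (S : set T) (u v w : T) (e : edge T) (x : le_boudec c F F').

Lemma subtree_convex S u v : subtree S -> S u -> S v ->
  forall k, S (walk c u (take k (word c u v))).
Proof.
move=> [_ Sc] Su Sv; have [p [pp pv pS]] := Sc u v Su Sv.
have [s [rs _ sv sS]] := path_reduced c pp.
rewrite -{1}pv -sv walkK //; exact: (sS S Su pS).
Qed.

Lemma subtree_star_shaped S u : S u ->
  (forall v, S v -> forall k, S (walk c u (take k (word c u v)))) -> subtree S.
Proof.
move=> Su Sc; split; first by exists u.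
move=> v w Sv Sw; pose s := rev (word c u v) ++ word c u w.
have vu : walk c v (rev (word c u v)) = u by rewrite -{1}(wordK c u v) walk_rev.
exists (scanl (nbr c) v s); split; first exact: walk_path.
  by rewrite last_scanl walk_cat vu wordK.
move=> y /(nthP v)[k]; rewrite size_scanl => ks <-.
rewrite nth_scanl // -[foldl _ _ _]/(walk c v _) /s take_cat.
case: ltnP => _; last by rewrite walk_cat vu; exact: Sc.
rewrite take_rev; set m := (_ - _)%N.
rewrite -{1}(wordK c u v) -{1}(cat_take_drop m (word c u v)) walk_cat walk_rev.
exact: Sc.
Qed.

(** A leaf v of one member stays a leaf of the intersection because the
    geodesic from v to the common edge leaves v by the only available
    neighbour. *)
Lemma Te_spec_bigcap e x (P : set (set T)) : P !=set0 -> P `<=` Te_spec e x ->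
  Te_spec e x (\bigcap_(S in P) S).
Proof.
move=> [S0 PS0] PT.
have Po S : P S -> S (origin e) by case/PT => _ [].
have Pt S : P S -> S (terminus e) by case/PT => _ [].
have Pc S v : P S -> S v -> forall k, S (walk c (origin e) (take k (word c (origin e) v))).
  move=> PS Sv; apply: subtree_convex => //; last exact: Po.
  by have [[]] := PT S PS.
split; [split| by split=> S PS; have [_ []] := PT S PS
       | by split=> S PS; have [_ _ []] := PT S PS|].
- apply: (@subtree_star_shaped _ (origin e)); first by move=> S /Po.
  by move=> v Iv k S PS; apply: Pc => //; exact: Iv.
- move=> v Iv.
  have [nI|] := pselect (forall S, P S -> neighbours v `<=` S).
    by left=> w vw S PS; apply: nI.
  move=> /existsNP[S] /not_implyP[PS nS].
  have [[_ /(_ v (Iv S PS))[//|[w Sw]]] _ _ _] := PT S PS.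
  right; exists w; apply/seteqP; split=> [y [Iy vy]|_ ->].
    by rewrite -Sw; split=> //; exact: Iy.
  suff [y Iy vy] : exists2 y, (\bigcap_(S in P) S) y & adj v y.
    suff -> : w = y by split.
    have : (S `&` neighbours v) y by split=> //; exact: Iy.
    by rewrite Sw.
  have [ve|ve] := eqVneq v (origin e).
    by exists (terminus e); [move=> R /Pt|rewrite ve; exact: edge_adj].
  have Pv R : P R -> forall k, R (walk c v (take k (word c v (origin e)))).
    move=> PR; apply: subtree_convex; [by have [[]] := PT R PR|exact: Iv|].
    exact: Po.
  case E: (word c v (origin e)) Pv => [|i s] Pv.
    by move: ve; rewrite -(wordK c v (origin e)) E eqxx.
  exists (nbr c v i); last exact: nbr_adj.
  by move=> R PR; have := Pv R PR 1%N; rewrite /= take0.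
move=> v xv; split=> [S PS|w vw S PS]; have [_ _ _ /(_ v xv)[Sv nS]] := PT S PS => //.
exact: nS.
Qed.

(** A ball is complete: a vertex on its boundary has exactly one neighbour nearer
    to the centre, all the others being farther away. *)
Lemma ball_Te_spec e x n : (dist c (origin e) ((x : aut T)^-1 (origin e)) <= n)%N ->
  singularities c F x `<=` vball c (origin e) n ->
  Te_spec e x (vball c (origin e) n.+1).
Proof.
move=> xe Sx; set o := origin e.
have ballS v w : vball c o n v -> adj v w -> vball c o n.+1 w.
  move=> vn vw; rewrite /vball /= (leq_trans (dist_triangle c v _ _)) //.
  by rewrite -[n.+1]addn1 leq_add // dist_adj.
have bo : vball c o n o by rewrite /vball /= dist_id.
have bW v : vball c o n v -> vball c o n.+1 v by move=> vn; rewrite /vball /= leqW.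
split; first split.
- apply: (@subtree_star_shaped _ o); first exact: bW.
  move=> v vn k; rewrite /vball /= (leq_trans (dist_walk _ _ _)) //.
  by rewrite (leq_trans _ vn) // size_take_min geq_minr.
- move=> v vn; case: (leqP (dist c o v) n) => [vn'|nv].
    by left=> w; exact: ballS.
  right; move: vn nv; rewrite /vball /= /dist.
  have := word_reduced c o v; have := wordK c o v.
  case/lastP: (word c o v) => [//|s i] <- rs; rewrite size_rcons !ltnS => sn ns.
  have sE : size s = n by apply/eqP; rewrite eqn_leq sn ns.
  have rs' := reduced_rconsW rs.
  exists (walk c o s); apply/seteqP; split=> [w [wn]|_ ->]; last first.
    split; first by rewrite /= walkK // sE.
    by rewrite /neighbours /= adj_sym walk_rcons; exact: nbr_adj.
  move=> /(adj_nbr c)[j wE]; have [ij|ij] := eqVneq i j.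
    by rewrite wE walk_rcons ij nbrK.
  have rj : reduced (rcons (rcons s i) j) by rewrite reduced_rcons2 rs.
  by move: wn; rewrite /= wE -walk_rcons walkK // !size_rcons sE ltnn.
- split; first exact: bW.
  exact: (ballS o _ bo (edge_adj e)).
- split; first exact: bW.
  by apply: (ballS ((x : aut T)^-1 o)) => //=; rewrite aut_inv_adj; exact: edge_adj.
move=> v /Sx vn; split; first exact: bW.
by move=> w; exact: ballS.
Qed.

(** The intersection of all admissible subtrees is admissible, hence it is the
    only minimal one. *)
Lemma Te_min e x S : Te_spec e x S -> Te_spec e x (Te e x) /\ Te e x `<=` S.
Proof.
move=> xS; pose I := \bigcap_(S in Te_spec e x) S.
have Ispec : Te_spec e x I by apply: Te_spec_bigcap => //; exists S.
have Imin : minimal_in (Te_spec e x) I.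
  by split=> // S' xS' S'I; apply/seteqP; split=> // v Iv; exact: Iv.
have [Tspec Tmin] : minimal_in (Te_spec e x) (Te e x).
  by apply: (@xgetPex _ set0); exists I.
split=> //; suff <- : I = Te e x by move=> v Iv; exact: Iv.
by apply: Tmin => // v Iv; exact: Iv.
Qed.

Lemma Te_ball e x n : (dist c (origin e) ((x : aut T)^-1 (origin e)) <= n)%N ->
  singularities c F x `<=` vball c (origin e) n ->
  Te_spec e x (Te e x) /\ Te e x `<=` vball c (origin e) n.+1.
Proof. by move=> xe Sx; apply/Te_min/ball_Te_spec. Qed.

Lemma Int_finite S : finite_set S -> finite_set (Int S).
Proof. by apply: sub_finite_set => v []. Qed.

Lemma Ne_le_ball e x n : (dist c (origin e) ((x : aut T)^-1 (origin e)) <= n)%N ->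
  singularities c F x `<=` vball c (origin e) n ->
  (Ne e x <= #|` fset_set (vball c (origin e) n.+1)|)%fset%N.
Proof.
move=> xe Sx; have [_ TB] := Te_ball xe Sx.
have fB := vball_finite c (origin e) n.+1.
apply: fsubset_leq_card; rewrite -fset_set_sub //.
- by move=> v [/TB].
- by apply: sub_finite_set fB => v [/TB].
Qed.

Lemma finite_bounded (I : choiceType) (A : set I) (f : I -> nat) :
  finite_set A -> exists n, forall i, A i -> (f i <= n)%N.
Proof.
move=> fA; exists (\max_(i <- fset_set A) f i) => i Ai.
by apply: leq_bigmax_seq => //; rewrite in_fset_set //; exact/mem_set.
Qed.

Lemma Te_finite e x : Te_spec e x (Te e x) /\ finite_set (Te e x).
Proof.
have [_ /(finite_bounded (dist c (origin e)))[n Sn]] := set_mem (valP x).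
pose m := maxn n (dist c (origin e) ((x : aut T)^-1 (origin e))).
have [|v /Sn vn|xT TB] := @Te_ball e x m; first exact: leq_maxr.
  by rewrite /vball /= (leq_trans vn) // leq_maxl.
by split=> //; apply: sub_finite_set TB _; exact: vball_finite.
Qed.

End HullOfSingularities.

(** * Bounds on indices *)

Section Index.
Context (G : groupType).
Implicit Types (A B C U V W : set G) (a b g h : G) (K L : nat).

(** The index of A `&` B in A is at most K: a colouring of A by K colours whose
    classes lie in left cosets of B. As B need not be contained in A, bounds of
    this kind compose along arbitrary chains. *)
Definition index_le A B K := exists f : G -> 'I_K,
  forall a b, A a -> A b -> f a = f b -> B (a^-1 * b).

Lemma index_le_fin (I : finType) A B (f : G -> I) :
  (forall a b, A a -> A b -> f a = f b -> B (a^-1 * b)) -> index_le A B #|I|.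
Proof.
move=> fP; exists (fun a => enum_rank (f a)) => a b Aa Ab /enum_rank_inj.
exact: fP.
Qed.

Lemma index_le_leq A B K L : (K <= L)%N -> index_le A B K -> index_le A B L.
Proof.
move=> KL [f fP]; exists (fun a => widen_ord KL (f a)) => a b Aa Ab.
by move=> /(congr1 val)/= /val_inj; exact: fP.
Qed.

(** An element of A is written as r b, where r is the representative of its
    colour; the second colour is that of b. *)
Lemma index_le_trans A B C K L :
  index_le A B K -> index_le B C L -> index_le A C (K * L).
Proof.
move=> [f fP] [h hP]; pose r k := xget 1 [set a | A a /\ f a = k].
have rP a : A a -> A (r (f a)) /\ f (r (f a)) = f a.
  by move=> Aa; apply: (@xgetPex _ 1 [set b | A b /\ f b = f a]); exists a.
rewrite (_ : (K * L)%N = #|{: 'I_K * 'I_L}|); last by rewrite card_prod !card_ord.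
apply: (@index_le_fin _ _ _ (fun a => (f a, h ((r (f a))^-1 * a)))).
move=> a b Aa Ab [fab]; rewrite -fab => hab.
have [Ar fr] := rP a Aa.
have := hP _ _ (fP _ _ Ar Aa fr) (fP _ _ Ar Ab (etrans fr fab)) hab.
by rewrite invgM invgK mulgA mulgK.
Qed.

Lemma index_le_conj g A B K :
  index_le A B K -> index_le (conjugate g A) (conjugate g B) K.
Proof.
move=> [f fP]; exists (fun a => f (g^-1 * a * g)).
have gK a : g^-1 * (g * a * g^-1) * g = a by rewrite !mulgA mulVg mul1g mulgKV.
move=> _ _ [a Aa <-] [b Ab <-]; rewrite !gK => /(fP _ _ Aa Ab) Bab.
by exists (a^-1 * b) => //; rewrite !invgM invgK !mulgA mulgKV.
Qed.

Lemma conjugateM g h A : conjugate g (conjugate h A) = conjugate (g * h) A.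
Proof.
apply/seteqP; split=> [_ [_ [a Aa <-] <-]|_ [a Aa <-]].
  by exists a => //; rewrite invgM !mulgA.
by exists (h * a * h^-1); [exists a|rewrite invgM !mulgA].
Qed.

Lemma conjugate1 A : conjugate 1 A = A.
Proof.
apply/seteqP; split=> [_ [a Aa <-]|a Aa]; first by rewrite mul1g invg1 mulg1.
by exists a => //; rewrite mul1g invg1 mulg1.
Qed.

Lemma conjugate_group g A : group_closed [in A] -> group_closed [in conjugate g A].
Proof.
move=> [/set_mem A1 AV]; split.
  by apply/mem_set; exists 1 => //; rewrite mulg1 mulgV.
move=> _ _ /set_mem[a Aa <-] /set_mem[b Ab <-]; apply/mem_set.
exists (a * b^-1); first by apply/set_mem/AV; exact/mem_set.
by rewrite !invgM invgK !mulgA mulgKV.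
Qed.

Lemma group_set1 A : group_closed [in A] -> A 1.
Proof. by case=> /set_mem. Qed.

Lemma group_setV A a : group_closed [in A] -> A a -> A a^-1.
Proof.
move=> [A1 AV] Aa; rewrite -[a^-1]mul1g; apply/set_mem/AV => //; exact/mem_set.
Qed.

Lemma group_setM A a b : group_closed [in A] -> A a -> A b -> A (a * b).
Proof.
move=> gA Aa Ab; rewrite -[b]invgK; have [_ AV] := gA.
by apply/set_mem/AV; apply/mem_set => //; exact: group_setV.
Qed.

Lemma group_setI A B : group_closed [in A] -> group_closed [in B] ->
  group_closed [in A `&` B].
Proof.
move=> gA gB; split; first by apply/mem_set; split; exact: group_set1.
move=> a b /set_mem[Aa Ba] /set_mem[Ab Bb]; apply/mem_set.
by split; apply: group_setM => //; exact: group_setV.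
Qed.

Section IndexOf.
Context (U V : set G).
Hypotheses (gU : group_closed [in U]) (gV : group_closed [in V]).
Let W := U `&` V.

Lemma lcosets_card_le K : index_le U V K -> (lcosets_of U W #<= `I_K)%card.
Proof.
move=> [f fP]; pose r k := xget 1 [set a | U a /\ f a = k :> nat].
apply: (@card_le_trans _ _ _ [set [set r k * w | w in W] | k in `I_K]); last first.
  exact: card_image_le.
apply: subset_card_le => _ [a Ua <-]; exists (f a) => //=.
have [Ur fr] : U (r (f a)) /\ f (r (f a)) = f a :> nat.
  by apply: (@xgetPex _ 1 [set b | U b /\ f b = f a :> nat]); exists a.
have Wra : W ((r (f a))^-1 * a).
  split; first by apply: group_setM => //; exact: group_setV.
  by apply: fP => //; exact: val_inj.
have gW : group_closed [in W] by exact: group_setI.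
apply/seteqP; split=> _ [w Ww <-].
  exists (((r (f a))^-1 * a)^-1 * w); last by rewrite invgM invgK !mulgA mulgV mul1g.
  by apply: group_setM => //; exact: group_setV.
exists ((r (f a))^-1 * a * w); last by rewrite !mulgA mulgV mul1g.
exact: group_setM.
Qed.

Lemma index_of_le K : index_le U V K -> (index_of U W <= K)%N.
Proof. by move/lcosets_card_le; exact: geq_card_fset_set. Qed.

Lemma index_of_gt0 K : index_le U V K -> (0 < index_of U W)%N.
Proof.
move/lcosets_card_le => UK.
have fL : finite_set (lcosets_of U W) by apply/finite_set_leP; exists K.
rewrite cardfs_gt0; apply/negP => /eqP L0.
have : [set 1 * w | w in W] \in fset_set (lcosets_of U W).
  by rewrite in_fset_set //; apply/mem_set; exists 1 => //; exact: group_set1.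
by rewrite L0.
Qed.

Lemma index_le_index_of K : index_le U V K -> index_le U V (index_of U W).
Proof.
move/lcosets_card_le => UK.
have fL : finite_set (lcosets_of U W) by apply/finite_set_leP; exists K.
pose L := fset_set (lcosets_of U W); pose co a := [set a * w | w in W].
have coL a : U a -> co a \in L.
  by move=> Ua; rewrite in_fset_set //; apply/mem_set; exists a.
rewrite /index_of cardfE.
apply: (@index_le_fin _ _ _ (fun a => insubd [` coL 1 (group_set1 gU)]%fset (co a))).
move=> a b Ua Ub /(congr1 val); rewrite !val_insubd !coL // => ab.
have : co b b by exists 1; [split; exact: group_set1|rewrite mulg1].
by rewrite -ab => -[w [_ Vw] <-]; rewrite mulKg.
Qed.

End IndexOf.

Lemma COS_dist_le (R : realType) U V K :
  group_closed [in U] -> group_closed [in V] -> (0 < K)%N ->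
  index_le U V K -> index_le V U K -> (COS_dist R U V <= ln (K ^ 2)%:R)%R.
Proof.
move=> gU gV K0 UV VU; rewrite /COS_dist -natrM.
have V0 : (0 < index_of V (U `&` V))%N by rewrite setIC (index_of_gt0 gV gU VU).
have VK : (index_of V (U `&` V) <= K)%N by rewrite setIC index_of_le.
rewrite ler_ln ?posrE ?ltr0n ?muln_gt0 ?expn_gt0 ?K0 ?V0 ?(index_of_gt0 gU gV UV) //.
by rewrite ler_nat -mulnn leq_mul // index_of_le.
Qed.

(** The bounds K and L, of no quantitative interest, ensure that the two cardinals
    in the distance are those of finite non-empty sets, hence positive: only then
    does a bound on the logarithm of their product bound each of them. *)
Lemma COS_dist_index_le (R : realType) U V K L (M : R) :
  group_closed [in U] -> group_closed [in V] -> index_le U V K ->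
  index_le V U L -> (COS_dist R U V <= M)%R ->
  index_le V U (Num.truncn (expR M)).+1.
Proof.
move=> gU gV UV VU dM; apply: (index_le_leq _ (index_le_index_of gV gU VU)).
move: dM; rewrite /COS_dist setIC -natrM.
have V0 := index_of_gt0 gV gU VU; have U0 := index_of_gt0 gU gV UV.
rewrite setIC in U0 *.
rewrite -ler_expR lnK ?posrE ?ltr0n ?muln_gt0 ?U0 // => dM.
rewrite -(ler_nat R); apply: (@le_trans _ _ (expR M)).
  by apply: le_trans dM; rewrite ler_nat leq_pmull.
exact/ltW/truncnS_gt.
Qed.

End Index.

(** * Compact open subgroups *)

Section CompactOpenSubgroups.
Context (d : nat) (T : regular_tree d) (c : legal_colouring T).
Context (F F' : {group {perm 'I_d}}).
Local Notation G := (le_boudec c F F').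
Implicit Types (g h x y : G) (v w : T) (U V : set G).

(* the finite subcover property of compact sets is stated for pointed spaces *)
HB.instance Definition _ := isPointed.Build G 1.

Lemma local_action_ext (a b : aut T) v : a v = b v ->
  (forall w, adj v w -> a w = b w) -> local_action c a v = local_action c b v.
Proof.
move=> av aw; apply/permP => i; apply: (@nbr_inj d T c (a v)).
by rewrite -aut_nbr aw ?nbr_adj // aut_nbr av.
Qed.

Lemma fixator_group A : group_closed [in @fixator d T c F F' A].
Proof.
split; first by apply/mem_set; exact: fixator1.
move=> x y /set_mem xA /set_mem yA; apply/mem_set/fixatorM => //.
exact: fixatorV.
Qed.

Lemma fixator_open A : finite_set A -> open (@fixator d T c F F' A).
Proof.
move=> fA; suff: le_boudec_open (@fixator d T c F F' A) by [].
move=> x xA; exists A => // u uF uA; exact: fixatorM.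
Qed.

Lemma fixator_dist A x v w : fixator A x -> A w -> dist c w (x v) = dist c w v.
Proof.
by move=> [_ xA] Aw; rewrite -{1}(xA w (mem_set Aw)) dist_aut.
Qed.

Lemma ultra_finite (X : Type) (I : choiceType) (FF : set_system X) (D : set I)
    (f : X -> I) : UltraFilter FF -> finite_set D ->
  FF [set x | D (f x)] -> exists i, FF [set x | f x = i].
Proof.
move=> uF fD FD; apply: contrapT => /forallNP nF.
have : FF (\bigcap_(i in [set` fset_set D]) [set x | f x <> i]).
  apply: filter_bigI => i _; have [/nF//|] := in_ultra_setVsetC [set x | f x = i] uF.
  by [].
move=> FnD; have [x [Dx nx]] := filter_ex (filterI FD FnD).
by apply: (nx (f x)) => //=; rewrite in_fset_set //; exact/mem_set.
Qed.

(** An ultrafilter on the stabiliser of a vertex decides the image of every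
    vertex, as this image lies in a finite ball; the decided images form the
    automorphism to which the ultrafilter converges. *)
Lemma fixator_compact (A : set T) : A !=set0 -> F \subset F' ->
  compact (@fixator d T c F F' A).
Proof.
move=> [o Ao] sF; rewrite compact_ultra => FF uF FA.
have ex_img v : exists w, FF [set x : G | x v = w].
  apply: (@ultra_finite _ _ _ (vball c o (dist c o v))) => //.
    exact: vball_finite.
  by apply: filterS FA => x xA; rewrite /vball /= (fixator_dist _ xA).
have ex_inv v : exists w, FF [set x : G | aut_inv x v = w].
  apply: (@ultra_finite _ _ _ (vball c o (dist c o v))) => //.
    exact: vball_finite.
  apply: filterS FA => x xA; rewrite /vball /= -(dist_aut c x) aut_invK.
  by rewrite (proj2 xA _ (mem_set Ao)).
have [a aF] := choice ex_img; have [b bF] := choice ex_inv.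
have abK : cancel b a.
  move=> v; have [x [/= <- xb]] := filter_ex (filterI (aF (b v)) (bF v)).
  by rewrite -xb aut_invK.
have baK : cancel a b.
  move=> v; have [x [/= <- xb]] := filter_ex (filterI (bF (a v)) (aF v)).
  by rewrite -xb aut_funK.
have aA u v : adj (a u) (a v) = adj u v.
  have [x [/= <- <-]] := filter_ex (filterI (aF u) (aF v)).
  exact: aut_adj.
pose p := Aut baK abK aA.
have near_p (B : set T) : finite_set B -> FF [set x : G | forall v, B v -> x v = p v].
  move=> fB; have : FF (\bigcap_(v in [set` fset_set B]) [set x : G | x v = p v]).
    by apply: filter_bigI => v _; exact: aF.
  apply: filterS => x xB v Bv; apply: xB => /=.
  by rewrite in_fset_set //; exact/mem_set.
have pF : burger_mozes c F p.
  move=> v; have fv : finite_set ([set v] `|` [set w | adj v w]).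
    by rewrite finite_setU; split=> //; exact: finite_neighbours.
  have [x [/= [xF _] xp]] := filter_ex (filterI FA (near_p _ fv)).
  rewrite -(@local_action_ext x); [exact: xF|by apply: xp; left|].
  by move=> w vw; apply: xp; right.
have pG : (p : aut T) \in le_boudec_set c F F'.
  by have := burger_mozes_le_boudec sF (SigSub (mem_set pF)).
exists (LeBoudec pG); split.
  split=> // v /set_mem Av.
  have [x [/= [_ xA] /(_ v erefl) <-]] := filter_ex (filterI FA (near_p _ (finite_set1 v))).
  by apply: xA; exact/mem_set.
move=> B /le_boudec_nbhsP[C fC CB].
have : FF [set x | fixator A x /\ forall v, C v -> x v = p v].
  by apply: filterI => //; exact: near_p.
apply: filterS => x [xA xC]; rewrite -[x](mulKVg (LeBoudec pG)); apply: CB.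
split.
  by apply: burger_mozesM; [exact: (burger_mozesV pF)|exact: xA.1].
by move=> v /set_mem Cv /=; rewrite xC //; exact: aut_funK.
Qed.

Lemma fixator_COS A : finite_set A -> A !=set0 -> F \subset F' ->
  COS (@fixator d T c F F' A).
Proof.
move=> fA A0 sF; split; first exact: fixator_group.
  exact: fixator_compact.
exact: fixator_open.
Qed.

(** A compact set is covered by finitely many left cosets of an open subgroup. *)
Lemma compact_index V U (B : set T) : compact U -> group_closed [in V] ->
  finite_set B -> fixator B `<=` V -> exists K, index_le U V K.
Proof.
move=> cU gV fB BV; pose f (a : G) := [set a * v | v in V].
have oV a : U a -> open (f a).
  move=> _; suff: le_boudec_open (f a) by [].
  move=> _ [v Vv <-]; exists B => // u uF uB; exists (v * u); last exact: mulgA.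
  by apply: group_setM => //; exact: BV.
have UV : U `<=` cover U f.
  by move=> a Ua; exists a => //; exists 1; [exact: group_set1|rewrite mulg1].
move: cU; rewrite compact_cover => /(_ _ _ _ oV UV)[D _ UD].
have [->|/set0P[a0 Ua0]] := eqVneq U set0; first by exists 1%N, (fun=> ord0).
have [i0 Di0 _] := UD a0 Ua0.
have ex_rep a : exists i : D, U a -> f (val i) a.
  have [Ua|nUa] := pselect (U a); last by exists [` Di0]%fset.
  by have [i Di fia] := UD a Ua; exists [` Di]%fset.
have [r rP] := choice ex_rep.
exists #|{: D}|; apply: (@index_le_fin _ _ _ _ r) => a b Ua Ub rab.
have [v Vv <-] := rP a Ua; have := rP b Ub; rewrite -rab => -[w Vw <-].
rewrite invgM !mulgA mulgKV; apply: group_setM => //; exact: group_setV.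
Qed.

Lemma open_fixator V : open V -> V 1 -> exists2 B : set T, finite_set B &
  @fixator d T c F F' B `<=` V.
Proof.
move=> oV V1; have : le_boudec_open V by [].
move=> /(_ 1 V1)[B fB BV]; exists B => // u [uF uB]; rewrite -[u]mul1g.
exact: BV.
Qed.

Lemma COS_index U V g : COS U -> COS V -> exists K, index_le U (conjugate g V) K.
Proof.
move=> [gU cU _] [gV _ oV]; have [B fB BV] := open_fixator oV (group_set1 gV).
have [C fC CB] := fixator_conj g fB.
apply: (compact_index cU (conjugate_group g gV) fC) => x xC.
exists (g^-1 * x * g); first exact/BV/CB.
by rewrite !mulgA mulgV mul1g mulgK.
Qed.

End CompactOpenSubgroups.

(** * Indices are bounded by the hull *)

Section IndexFromHull.
Context (d : nat) (T : regular_tree d) (c : legal_colouring T).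
Context (F F' : {group {perm 'I_d}}).
Local Notation G := (le_boudec c F F').
Implicit Types (x y : G) (v w : T) (S : set T) (e : edge T).

(** The compact open subgroup U(F)_e, with respect to which all displacements in
    COS(G) are measured. *)
Definition edge_group e : set G := fixator [set origin e; terminus e].

Lemma edge_groupP e x : edge_group e x <->
  [/\ burger_mozes c F x, x (origin e) = origin e & x (terminus e) = terminus e].
Proof.
split=> [[xF xe]|[xF xo xt]]; last by split=> // v /set_mem[] ->.
by split=> //; apply: xe; apply/mem_set; [left|right].
Qed.

Lemma conj_edge_groupP e x y : conjugate x^-1 (edge_group e) y <->
  edge_group e (x * y * x^-1).
Proof.
split=> [[z ze <-]|xye]; first by rewrite invgK !mulgA mulgV mul1g mulgK.
by exists (x * y * x^-1) => //; rewrite invgK !mulgA mulVg mul1g mulgKV.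
Qed.

(** Propagation along a path of S: an interior vertex passes the agreement on to
    all its neighbours, a leaf has no neighbour in S but the previous vertex. *)
Lemma agree_on_complete_subtree (a b : aut T) S e :
  complete_subtree S -> edge_of S e ->
  a (origin e) = b (origin e) -> a (terminus e) = b (terminus e) ->
  (forall v, Int S v -> local_action c a v = local_action c b v) ->
  forall v, S v -> a v = b v.
Proof.
move=> [[_ Sc] Sl] [So St] abo abt abS v Sv.
have [p [pp <- pS]] := Sc (origin e) v So Sv.
have: adj (terminus e) (origin e) by rewrite adj_sym; exact: edge_adj.
elim: p (origin e) (terminus e) So St abo abt pp pS {Sv} => [//|w p IH] u u' Su Su' au au'.
move=> /= /andP[uw wp] pS u'u.
have Sw : S w by apply: pS; rewrite inE eqxx.
apply: (IH w u) => //; last by move=> z zp; apply: pS; rewrite inE zp orbT.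
have [uI|[z Sz]] := Sl u Su.
  have [i ->] := adj_nbr c uw.
  by rewrite !aut_nbr au abS.
have wz : w = z by have : (S `&` neighbours u) w by []; rewrite Sz.
suff -> : w = u' by [].
have : (S `&` neighbours u) u' by split=> //; rewrite /neighbours /= adj_sym.
by rewrite Sz wz.
Qed.

Lemma local_action_conj x y v :
  local_action c (x * y * x^-1) (x v) =
  (local_action c x v)^-1 * local_action c y v * local_action c x (y v).
Proof. by rewrite !local_actionM local_actionV /= aut_funK mulgA. Qed.

(** At x v the local action of x y x^-1 differs from that of y at v by the local
    actions of x at v and y v. These lie in F unless v or y v is a singularity
    of x, and then y fixes v together with all its neighbours. *)
Lemma burger_mozes_conj x y S : singularities c F x `<=` Int S ->
  (forall v, S v -> y v = v) ->
  burger_mozes c F y <-> burger_mozes c F (x * y * x^-1 : G).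
Proof.
move=> xS yS.
have loc v : (local_action c (x * y * x^-1) (x v) \in F) =
             (local_action c y v \in F).
  rewrite local_action_conj; have [xv|/xS[Sv nS]] := boolP (local_action c x v \in F).
    have [xyv|/xS[Syv _]] := boolP (local_action c x (y v) \in F).
      by rewrite groupMr // groupMl // groupV.
    have yv : y v = v by have := yS _ Syv; exact: (can_inj (aut_funK y)).
    by rewrite yv groupMr // groupMl // groupV.
  have -> : local_action c y v = 1.
    by apply: (@local_action_fix d T c y) => [|w vw]; apply: yS => //; exact: nS.
  by rewrite yS // mulg1 mulVg group1.
split=> [yF v|xyF v]; last first.
  by have := xyF (x v); rewrite loc.
by have := yF (aut_inv x v); rewrite -loc aut_invK.
Qed.

(** Elements that agree on an edge of the hull of x are equal on the whole hull
    once their local actions coincide on its interior. An element fixing the hull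
    pointwise lies in U(F)_e if and only if it lies in x^-1 U(F)_e x. Hence the
    local actions on the interior separate the cosets, in both directions. *)
Lemma index_le_hull e x :
  index_le (edge_group e) (conjugate x^-1 (edge_group e))
    (#|{: {perm 'I_d}}| ^ Ne e x) /\
  index_le (conjugate x^-1 (edge_group e)) (edge_group e)
    (#|{: {perm 'I_d}}| ^ Ne e x).
Proof.
have [[Sc Se Sxe xS] fS] := Te_finite e x.
set S := Te e x in Sc Se Sxe xS fS.
have fI : finite_set (Int S) by exact: Int_finite.
pose C := {ffun fset_set (Int S) -> {perm 'I_d}}.
rewrite (_ : (_ ^ _)%N = #|{: C}|); last by rewrite card_ffun -cardfE.
pose f (y : G) : C := [ffun v => local_action c y (val v)].
have fE (a b : G) v : f a = f b -> Int S v -> local_action c a v = local_action c b v.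
  move=> /ffunP fab Iv; have vI : v \in fset_set (Int S).
    by rewrite in_fset_set //; exact/mem_set.
  by have := fab [` vI]%fset; rewrite !ffunE.
have quo (a b : G) : (forall v, S v -> a v = b v) -> forall v, S v -> (a^-1 * b) v = v.
  by move=> ab v Sv /=; rewrite -ab //; exact: aut_funK.
split; apply: (@index_le_fin _ _ _ _ f) => a b Ea Eb fab.
  have [aF ao at_] := (edge_groupP e a).1 Ea; have [bF bo bt] := (edge_groupP e b).1 Eb.
  have abS := quo a b (agree_on_complete_subtree Sc Se
    (etrans ao (esym bo)) (etrans at_ (esym bt)) (fE a b ^~ fab)).
  have abF : burger_mozes c F (a^-1 * b) by apply: burger_mozesM => //; exact: burger_mozesV.
  apply/conj_edge_groupP/edge_groupP; split; first by apply/(burger_mozes_conj xS abS).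
    by have := abS _ Sxe.1 => /= ->; exact: aut_invK.
  by have := abS _ Sxe.2 => /= ->; exact: aut_invK.
move: Ea Eb => /conj_edge_groupP Ea /conj_edge_groupP Eb.
have [aF ao at_] := (edge_groupP _ _).1 Ea; have [bF bo bt] := (edge_groupP _ _).1 Eb.
have abo : a ((x : aut T)^-1 (origin e)) = b ((x : aut T)^-1 (origin e)).
  by apply: (can_inj (aut_funK x)); move: ao bo => /= -> ->.
have abt : a ((x : aut T)^-1 (terminus e)) = b ((x : aut T)^-1 (terminus e)).
  by apply: (can_inj (aut_funK x)); move: at_ bt => /= -> ->.
have abS := quo a b (agree_on_complete_subtree Sc Sxe abo abt (fE a b ^~ fab)).
apply/edge_groupP; split; [|exact: abS Se.1|exact: abS Se.2].
apply/(burger_mozes_conj xS abS).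
rewrite (_ : x * (a^-1 * b) * x^-1 = (x * a * x^-1)^-1 * (x * b * x^-1)).
  exact: (fixatorM (fixatorV Ea) Eb).1.
by rewrite !invgM invgK !mulgA mulgKV.
Qed.

End IndexFromHull.

(** * Orbits of the edge stabiliser *)

Section Twist.
Context (d : nat) (q : seq 'I_d) (a : 'I_d).
Implicit Types (f : {perm 'I_d}) (s r : seq 'I_d) (i : 'I_d).
Let p := rcons q a.

(** On words read from a base vertex, this map is an automorphism when f fixes a:
    its local action is f on the half-tree of the words extending q a, and trivial
    elsewhere. *)
Definition twist f s := if prefix p s then p ++ map f (drop (size p) s) else s.

Lemma twist_cat f r : twist f (p ++ r) = p ++ map f r.
Proof. by rewrite /twist prefix_prefix drop_size_cat. Qed.

Lemma twistK f : cancel (twist f) (twist f^-1).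
Proof.
move=> s; rewrite {2}/twist; case: ifP => [/prefixP[r ->]|ps].
  by rewrite drop_size_cat // twist_cat mapK //; exact: permK.
by rewrite /twist ps.
Qed.

Lemma twist_short f s : (size s <= size p)%N -> twist f s = s.
Proof.
move=> sp; rewrite /twist; case: ifP => // /prefixP[r sE].
move: sp; rewrite sE size_cat -[leqRHS]addn0 leq_add2l leqn0 size_eq0 => /eqP->.
by rewrite cats0 drop_size cats0.
Qed.

Definition twist_action f s : {perm 'I_d} := if prefix p s then f else 1.

Lemma twist_rcons f s i : twist f (rcons s i) = rcons (twist f s) (twist_action f s i).
Proof.
rewrite /twist_action; case: ifP => [/prefixP[r ->]|ps].
  by rewrite rcons_cat !twist_cat map_rcons rcons_cat.
rewrite perm1 /twist ps; case: ifP => // /prefixP[r].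
case/lastP: r => [|r j].
  by rewrite cats0 => ->; rewrite drop_size cats0.
rewrite -rcons_cat => /rcons_inj[sE _].
by move: ps; rewrite sE prefix_prefix.
Qed.

Lemma reduced_twist f s : f a = a -> reduced s -> reduced (twist f s).
Proof.
move=> fa; rewrite /twist; case: ifP => // /prefixP[r ->].
rewrite drop_size_cat // !reduced_rcons_cat => /andP[-> /=].
rewrite -{2}fa path_map; apply: sub_path => i j /=.
by rewrite (inj_eq perm_inj).
Qed.

(** Twice the same edge, from its two ends: on the edge entering the half-tree, the
    local actions f and 1 agree because f fixes the colour a. *)
Lemma twist_action_rcons f s i : f a = a ->
  twist_action f (rcons s i) i = twist_action f s i.
Proof.
move=> fa; have := twist_rcons f s i; rewrite /twist_action.
have [/prefixP[r ->]|ps] := boolP (prefix p s).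
  by rewrite rcons_cat prefix_prefix.
rewrite perm1; case: ifP => [/prefixP[r]|]; last by rewrite perm1.
case/lastP: r => [|r j]; first by rewrite cats0 /p => /rcons_inj[_ ->].
rewrite -rcons_cat => /rcons_inj[sE _].
by move: ps; rewrite sE prefix_prefix.
Qed.

End Twist.

Section Switch.
Context (d : nat) (T : regular_tree d) (c : legal_colouring T).
Context (F F' : {group {perm 'I_d}}).
Local Notation G := (le_boudec c F F').
Implicit Types (o v w : T) (s r q : seq 'I_d) (a i : 'I_d) (f : {perm 'I_d}).

Definition switch_fun o q a (f : {perm 'I_d}) v := walk c o (twist q a f (word c o v)).

Lemma switch_funK o q a f : f a = a -> cancel (switch_fun o q a f) (switch_fun o q a f^-1).
Proof.
move=> fa v; rewrite {1}/switch_fun walkK; last exact/reduced_twist/word_reduced.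
by rewrite twistK wordK.
Qed.

Lemma switch_nbr o q a (f : {perm 'I_d}) v i : f a = a -> switch_fun o q a f (nbr c v i) =
  nbr c (switch_fun o q a f v) (twist_action q a f (word c o v) i).
Proof.
move=> fa.
(* the longer of the two words is that of nbr v i *)
have away w j : reduced (rcons (word c o w) j) -> switch_fun o q a f (nbr c w j) =
    nbr c (switch_fun o q a f w) (twist_action q a f (word c o w) j).
  move=> rj; rewrite /switch_fun -{1}(wordK c o w) -walk_rcons walkK //.
  by rewrite twist_rcons walk_rcons.
have [rvi|] := boolP (reduced (rcons (word c o v) i)); first exact: away.
have := word_reduced c o v; have := wordK c o v.
case/lastP E: (word c o v) => [//|s j] vE rs.
have [ij|ij] := eqVneq j i; last first.
  by rewrite reduced_rcons2 rs ij.
move=> _; rewrite ij in E vE rs *.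
have wE : word c o (nbr c v i) = s.
  by rewrite -vE walk_rcons nbrK walkK //; exact: reduced_rconsW rs.
have := away (nbr c v i) i; rewrite wE nbrK => -> //.
by rewrite twist_action_rcons // nbrK.
Qed.

Lemma switch_ex (e : edge T) q a (f : {perm 'I_d}) : F \subset F' -> f \in F -> f a = a ->
  exists u : G, edge_group e u /\ forall s, reduced s ->
    u (walk c (origin e) s) = walk c (origin e) (twist q a f s).
Proof.
move=> sF fF fa; set o := origin e.
have fVa : f^-1 a = a by rewrite -{1}fa permK.
have fK := switch_funK o q fa.
have fVK : cancel (switch_fun o q a f^-1) (switch_fun o q a f).
  by have := switch_funK o q fVa; rewrite invgK.
have sA (h : {perm 'I_d}) v w : h a = a -> adj v w -> adj (switch_fun o q a h v) (switch_fun o q a h w).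
  by move=> ha /(adj_nbr c)[i ->]; rewrite switch_nbr //; exact: nbr_adj.
have fA v w : adj (switch_fun o q a f v) (switch_fun o q a f w) = adj v w.
  by apply/idP/idP => [/(sA f^-1)|]; [rewrite !fK; exact|exact: sA].
pose u := Aut fK fVK fA.
have us s : reduced s -> u (walk c o s) = walk c o (twist q a f s).
  by move=> rs; rewrite /= /switch_fun walkK.
have uF : burger_mozes c F u.
  move=> v; rewrite (_ : local_action c u v = twist_action q a f (word c o v)).
    by rewrite /twist_action; case: ifP.
  apply/permP => i; apply: (@nbr_inj d T c (u v)).
  by rewrite -aut_nbr [LHS]switch_nbr.
have uG : (u : aut T) \in le_boudec_set c F F'.
  by have := burger_mozes_le_boudec sF (SigSub (mem_set uF)).
exists (LeBoudec uG); split=> //; apply/edge_groupP; split=> //=.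
  by have := us [::] isT; rewrite twist_short.
have := us [:: c e] isT; rewrite twist_short ?size_rcons //=.
by rewrite nbr_terminus.
Qed.

Lemma two_transitive_fix a i j : [transitive^2 F, on [set: 'I_d]%SET | 'P] ->
  a != i -> a != j -> exists f : {perm 'I_d}, [/\ f \in F, f a = a & f i = j].
Proof.
move=> F2 ai aj.
have dt k : a != k -> [tuple a; k] \in 2.-dtuple([set: 'I_d]%SET).
  by move=> ak; rewrite !dtuple_on_add !inE ak /= memtE subset_all.
have [f fF] := atransP2 F2 (dt i ai) (dt j aj).
by move=> /(congr1 val)[fa fi]; exists f.
Qed.

(** 2-transitivity lets the letters of a reduced word be corrected one by one,
    from the base vertex outwards, without disturbing those already right. *)
Lemma edge_group_transitive (e : edge T) q a r r' :
  F \subset F' -> [transitive^2 F, on [set: 'I_d]%SET | 'P] ->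
  reduced (rcons q a ++ r) -> reduced (rcons q a ++ r') -> size r = size r' ->
  exists u : G, edge_group e u /\
    u (walk c (origin e) (rcons q a ++ r)) = walk c (origin e) (rcons q a ++ r').
Proof.
move=> sF F2; elim: r' q a r => [|j r' IH] q a [|i r] //= R R' => [_|[sr]].
  by exists 1; split=> //; exact: fixator1.
have [ai aj] : a != i /\ a != j.
  by move: R R'; rewrite !reduced_rcons_cat /= => /and3P[_ -> _] /and3P[_ -> _].
have [f [fF fa fi]] := two_transitive_fix F2 ai aj.
have [u [ue us]] := switch_ex e q sF fF fa.
have uE := us _ R; rewrite twist_cat /= fi in uE.
have Rf : reduced (rcons (rcons q a) j ++ map f r).
  by have := reduced_twist q fa R; rewrite twist_cat /= fi -cat_rcons.
have Rj : reduced (rcons (rcons q a) j ++ r') by rewrite cat_rcons.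
have [|u' [u'e u's]] := IH _ _ _ Rf Rj; first by rewrite size_map.
exists (u' * u); split; first exact: fixatorM.
by rewrite /= uE -cat_rcons u's cat_rcons.
Qed.

(** As there are at least three colours, every letter can be followed by either of
    two letters, which embeds a binary tree in the tree of reduced words. *)
Section BranchingWords.
Variable nxt : 'I_d -> bool -> 'I_d.
Hypothesis nxt_neq : forall a b, a != nxt a b.
Hypothesis nxt_inj : forall a, injective (nxt a).

Fixpoint branch a (bs : seq bool) : seq 'I_d :=
  if bs is b :: bs' then nxt a b :: branch (nxt a b) bs' else [::].

Lemma size_branch a bs : size (branch a bs) = size bs.
Proof. by elim: bs a => //= b bs IH a; rewrite IH. Qed.

Lemma branch_path a bs : path (fun i j => i != j) a (branch a bs).
Proof. by elim: bs a => //= b bs IH a; rewrite nxt_neq IH. Qed.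

Lemma branch_inj a : injective (branch a).
Proof.
move=> bs bs'; elim: bs bs' a => [|b bs IH] [|b' bs'] a //= [/nxt_inj <-].
by move/IH ->.
Qed.

End BranchingWords.

(** The orbit consists of all reduced words of the same length with the same first
    letter, among which are the branching words. *)
Lemma edge_group_orbit (e : edge T) v : (2 < d)%N ->
  F \subset F' -> [transitive^2 F, on [set: 'I_d]%SET | 'P] ->
  exists u : (dist c (origin e) v).-1.-tuple bool -> G,
    (forall t, edge_group e (u t)) /\ injective (fun t => u t v).
Proof.
move=> d2 sF F2.
have /choice[nxt nxtP] : forall a : 'I_d, exists n : bool -> 'I_d,
    (forall b, a != n b) /\ injective n.
  move=> a; have : (1 < #|[set~ a]%SET|)%N by rewrite cardsC1 card_ord -ltnS prednK // ltnW // ltnW.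
  case/card_gt1P => i [j [ia ja ij]]; exists (fun b => if b then i else j).
  move: ia ja; rewrite !inE => ia ja.
  split=> [[]|[] []] //; rewrite 1?eq_sym // => E; by rewrite E eqxx in ij.
have := wordK c (origin e) v; have := word_reduced c (origin e) v.
rewrite /dist; case: (word c (origin e) v) => [|a r] R vE /=.
  exists (fun=> 1); split=> [t|t t' _]; first exact: fixator1.
  by rewrite (tuple0 t) (tuple0 t').
have rb (t : (size r).-tuple bool) : reduced (a :: branch nxt a t).
  by apply: branch_path => i b; have [] := nxtP i.
have /choice[u uP] (t : (size r).-tuple bool) : exists u : G, edge_group e u /\
    u v = walk c (origin e) (a :: branch nxt a t).
  rewrite -vE; apply: (@edge_group_transitive e [::] a) => //.
    exact: rb.
  by rewrite size_branch size_tuple.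
exists u; split=> [t|t t' /=]; first by have [] := uP t.
rewrite (uP t).2 (uP t').2 => E; apply: val_inj; apply: (@branch_inj nxt _ a).
  by move=> i; have [] := nxtP i.
by case: (reduced_walk_inj (rb t) (rb t') E).
Qed.

(** The large orbit of v under U(F)_e is covered by K translates of its orbit under
    the intersection with B, so that the latter is large too. *)
Lemma orbit_count (e : edge T) v (B : set G) K (Z : finType) (code : T -> Z) :
  (2 < d)%N -> F \subset F' -> [transitive^2 F, on [set: 'I_d]%SET | 'P] ->
  index_le (edge_group e) B K ->
  (forall x y : G, edge_group e x -> B x -> edge_group e y -> B y ->
    code (x v) = code (y v) -> x v = y v) ->
  (2 ^ (dist c (origin e) v).-1 <= K * #|Z|)%N.
Proof.
move=> d2 sF F2 [f fP] codeP; have [u [uE u_inj]] := edge_group_orbit e v d2 sF F2.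
pose rep k := xget 1 [set g | edge_group e g /\ f g = k].
have repP g : edge_group e g -> edge_group e (rep (f g)) /\ f (rep (f g)) = f g.
  by move=> Eg; apply: (@xgetPex _ 1 [set h | edge_group e h /\ f h = f g]); exists g.
pose h t := (f (u t), code (((rep (f (u t)))^-1 * u t) v)).
have h_inj : injective h.
  move=> t t' [ft]; have [Er fr] := repP _ (uE t).
  have Eu t1 : edge_group e ((rep (f (u t)))^-1 * u t1).
    exact: fixatorM (fixatorV Er) (uE t1).
  have Bu t1 : f (u t1) = f (u t) -> B ((rep (f (u t)))^-1 * u t1).
    by move=> ft1; apply: fP => //; rewrite fr.
  rewrite -ft => /(codeP _ _ (Eu t) (Bu t erefl) (Eu t') (Bu t' (esym ft))).
  move=> E; apply: u_inj => /=; apply: (can_inj (aut_invK (rep (f (u t))))).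
  exact: E.
by have := leq_card h h_inj; rewrite card_prod card_tuple card_bool card_ord.
Qed.

End Switch.

(** * Displacement of hyperbolic automorphisms *)

Section Hyperbolic.
Context (d : nat) (T : regular_tree d) (c : legal_colouring T).
Implicit Types (u v w : T) (s : seq 'I_d).

(** Take v with minimal displacement. The geodesics from v to h v and from h v to
    h^2 v do not backtrack at h v, since otherwise the next vertex on the
    geodesic would have a smaller displacement, or the edge from v to h v would
    be inverted. So the translates of the geodesic form a geodesic line. *)
Lemma hyperbolic_displacement (h : aut T) u : hyperbolic h ->
  exists v, forall n, (n <= dist c v ((h ^+ n)%g v))%N.
Proof.
move=> hyp.
have ex : exists n, `[< exists v, dist c v (h v) = n >].
  by exists (dist c u (h u)); apply/asboolP; exists u.
case: (ex_minnP ex) => m /asboolP[v vm] mP.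
have {mP} vmin w : (dist c v (h v) <= dist c w (h w))%N.
  by rewrite vm; apply: mP; apply/asboolP; exists w.
exists v; have rs := word_reduced c v (h v); have sE := wordK c v (h v).
move: vmin; rewrite /dist; set s := word c v (h v) in rs sE * => vmin.
case E : s => [|i s1].
  exfalso; apply: hyp; exists [set v]; split; [exact: finite_set1|by exists v|].
  by rewrite image_set1 -sE E.
have [q [l sql]] : exists q l, s = rcons q l.
  by case/lastP: (s) E => [//|q l] _; exists q, l.
have hv1 : h (nbr c v i) = nbr c (h v) (local_action c h v i) by rewrite aut_nbr.
have li : l != local_action c h v i.
  apply/eqP => li; have hv1q : h (nbr c v i) = walk c v q.
    by rewrite hv1 -li -sE sql walk_rcons nbrK.
  case: q sql hv1q => [|j q] sql hv1q.
    apply: hyp; exists [set v; h v]; split.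
    - by rewrite finite_setU; split; exact: finite_set1.
    - by exists v; left.
    have v1 : nbr c v i = h v by rewrite -sE E; move: sql; rewrite E => -[_ ->].
    rewrite image_setU !image_set1 -{2}v1 hv1q /=.
    exact: setUC.
  have ji : j = i by move: sql; rewrite E => -[].
  have := vmin (nbr c v i); rewrite leqNgt => /negP[].
  rewrite -/(dist c _ _) hv1q -ji /=; apply: leq_ltn_trans (dist_walk _ _ _) _.
  by rewrite sql size_rcons /= ltnS.
suff step : forall n, exists t, [/\ reduced (i :: t), (n <= size t)%N &
    walk c v (i :: t) = (h ^+ n.+1)%g v].
  case=> [//|n]; have [t [rt nt <-]] := step n.
  by rewrite walkK.
elim=> [|n [t [rt nt tE]]].
  by exists s1; rewrite -E; split=> //; rewrite expg1.
exists (s1 ++ act_word c h v (i :: t)).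
have catE : i :: s1 ++ act_word c h v (i :: t) = s ++ act_word c h v (i :: t) by rewrite E.
rewrite !catE; split.
- have := reduced_act_word c h v rt.
  by rewrite sql reduced_rcons_cat -sql rs /= li.
- rewrite size_cat /= size_act_word addnS ltnS; exact: leq_trans nt (leq_addl _ _).
- by rewrite walk_cat sE walk_act_word tE [in RHS]expgS.
Qed.

(** The n-th iterate moves some v by at least n; if it carries w into S, this
    displacement is at most the distance from v to w plus that from v to S. *)
Lemma hyperbolic_visit (h : aut T) u (S : set T) : hyperbolic h -> finite_set S ->
  exists C, forall n w, S ((h ^+ n)%g w) -> (n <= dist c u w + C)%N.
Proof.
move=> hyp fS; have [v vP] := hyperbolic_displacement u hyp.
have [B BP] := finite_bounded (dist c v) fS.
exists (dist c u v + B)%N => n w Sw; apply: leq_trans (vP n) _.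
apply: leq_trans (dist_triangle c ((h ^+ n)%g w) _ _) _.
rewrite dist_aut addnC addnA leq_add ?BP //.
by rewrite -[leqRHS]/(_ + _)%N (dist_sym c u w) dist_triangle.
Qed.

End Hyperbolic.

(** * Singularities of g^-P h^Q *)

(** From (n+1)^2 <= 4 * 2^n. *)
Lemma exp2_linear A n : (2 ^ n.-1 <= A * n.+1)%N -> (n <= 8 * A)%N.
Proof.
have sq k : (k.+1 * k.+1 <= 4 * 2 ^ k)%N.
  elim: k => [//|[//|[//|[//|k]]]] IH; rewrite expnS mulnCA.
  apply: leq_trans (leq_mul (leqnn 2) IH); nia.
case: n => [//|k] /= kA; rewrite -(@leq_pmul2r k.+1) //.
apply: leq_trans (sq k) _.
apply: (@leq_trans (4 * (A * k.+2))); first by rewrite leq_mul2l.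
nia.
Qed.

Section Growth.
Context (d : nat) (T : regular_tree d) (c : legal_colouring T).
Context (F F' : {group {perm 'I_d}}).
Local Notation G := (le_boudec c F F').
Implicit Types (g h x y : G) (v w : T).

Lemma le_boudec_autX g n : le_boudec_aut (g ^+ n) = (le_boudec_aut g) ^+ n.
Proof. by elim: n => [//|n IH]; rewrite !expgS -IH. Qed.

Lemma singularitiesM (a b : aut T) w : singularities c F (a * b) w ->
  singularities c F b w \/ singularities c F a (b w).
Proof.
rewrite /singularities /= local_actionM => ab.
have [bF|] := boolP (local_action c b w \in F); last by left.
by right; rewrite groupMl in ab.
Qed.

Lemma singularitiesV (a : aut T) w : singularities c F a^-1 w ->
  singularities c F a (a^-1 w).
Proof. by rewrite /singularities /= local_actionV groupV. Qed.

Lemma singularitiesX (a : aut T) n w : singularities c F (a ^+ n) w ->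
  exists i, singularities c F a ((a ^+ i) w).
Proof.
elim: n w => [|n IH] w.
  by rewrite /singularities /= expg0 local_action1 group1.
rewrite expgSr => /singularitiesM[aw|/IH[i ai]]; first by exists 0%N.
by exists i.+1; rewrite expgSr.
Qed.

(** Let W be the intersection of U(F)_e and x^-1 U(F)_e x. It preserves the
    singularities of x = g^-P h^Q. If v is one of them, at distance n, its orbit
    under W consists of singularities at distance n and has at least 2^(n-1) / K
    elements. On the other hand, if w is a singularity of x, then h^i w is one of h
    for some i, or g^i (x w) is one of g. Since g and h are hyperbolic, i is at
    most n + C when w is at distance n, so there are only O(n) choices for w.
    For an arbitrary x the index gives no such bound: when F is normal in F', the
    singularities of x may fill large spheres around e although x normalises
    U(F)_e. *)
Lemma singularities_bounded (e : edge T) g h K : (2 < d)%N -> F \subset F' ->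
  [transitive^2 F, on [set: 'I_d]%SET | 'P] -> hyperbolic g -> hyperbolic h ->
  exists D, forall P Q, let x := g ^- P * h ^+ Q in
    index_le (edge_group e) (conjugate x^-1 (edge_group e)) K ->
    (dist c (origin e) ((x : aut T)^-1 (origin e)) <= D)%N /\
    singularities c F x `<=` vball c (origin e) D.
Proof.
move=> d2 sF F2 hg hh; set o := origin e.
have fS y : finite_set (singularities c F y) by have [] := set_mem (valP y).
have [Cg gC] := hyperbolic_visit c o hg (fS g).
have [Ch hC] := hyperbolic_visit c o hh (fS h).
pose Sg := fset_set (singularities c F g); pose Sh := fset_set (singularities c F h).
pose A := (K * (#|{: Sh}| * Ch.+1 + #|{: Sg}| * (K + Cg).+1))%N.
exists (maxn K (8 * A)) => P Q x xK.
(* W fixes x^-1 o, whose orbit under U(F)_e therefore has at most K elements *)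
have xo : (dist c o ((x : aut T)^-1 o) <= K)%N.
  have := @orbit_count _ _ _ _ _ e ((x : aut T)^-1 o) _ K unit (fun=> tt) d2 sF F2 xK.
  rewrite card_unit muln1 => /(_ _) lt.
  have fixv y : conjugate x^-1 (edge_group e) y -> y ((x : aut T)^-1 o) = (x : aut T)^-1 o.
    move=> /conj_edge_groupP/edge_groupP[_ yo _].
    apply: (can_inj (aut_funK x)); apply: etrans yo _.
    exact: esym (aut_invK x o).
  case: (dist _ _ _) lt => [//|n] /= lt.
  apply: leq_trans (ltn_expl n (leqnn 2)) (lt _) => y z _ By _ Bz _.
  by rewrite !fixv.
split; first by rewrite leq_max xo.
move=> v xv; rewrite /vball /= leq_max; apply/orP; right.
set D := dist c o v; apply: exp2_linear.
(* the singularity of h or g that is visited, with the time of the visit *)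
pose Z := ((Sh * 'I_(D + Ch).+1) + (Sg * 'I_(D + K + Cg).+1))%type.
pose decode (z : Z) : T := match z with
  | inl (s, i) => ((h : aut T) ^+ i)^-1 (val s)
  | inr (s, i) => (x : aut T)^-1 (((g : aut T) ^+ i)^-1 (val s)) end.
have decodeP w : singularities c F x w -> dist c o w = D -> exists z, decode z = w.
  move=> xw wD; have inS y u : singularities c F y u -> u \in fset_set (singularities c F y).
    by move=> yu; rewrite in_fset_set //; exact/mem_set.
  have xE : le_boudec_aut x = ((g : aut T) ^+ P)^-1 * (h : aut T) ^+ Q.
    by rewrite -!le_boudec_autX.
  move: (xw); rewrite xE => /singularitiesM[/singularitiesX[i hi]|].
    have iD : (i < (D + Ch).+1)%N by rewrite ltnS -wD hC.
    exists (inl ([` inS _ _ hi]%fset, Ordinal iD)) => /=.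
    by rewrite aut_funK.
  move=> /singularitiesV.
  have -> : ((g : aut T) ^+ P)^-1 (((h : aut T) ^+ Q) w) = x w by rewrite xE.
  move=> /singularitiesX[i gi].
  have iD : (i < (D + K + Cg).+1)%N.
    rewrite ltnS; apply: leq_trans (gC _ _ gi) _; rewrite leq_add2r.
    apply: leq_trans (dist_triangle c ((x : aut T) o) _ _) _.
    rewrite dist_aut wD addnC leq_add2l -{1}(aut_invK x o) dist_aut dist_sym.
    exact: xo.
  exists (inr ([` inS _ _ gi]%fset, Ordinal iD)).
  apply: etrans (congr1 (aut_inv x) (aut_funK ((g : aut T) ^+ i) (x w))) _.
  exact: aut_funK.
have [z0 _] := decodeP v xv erefl.
have /choice[code codeP] : forall w, exists z,
    singularities c F x w /\ dist c o w = D -> decode z = w.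
  move=> w; have [[xw wD]|n] := pselect (singularities c F x w /\ dist c o w = D).
    by have [z zw] := decodeP w xw wD; exists z.
  by exists z0.
have stab y : edge_group e y -> conjugate x^-1 (edge_group e) y ->
    singularities c F x (y v) /\ dist c o (y v) = D.
  move=> ye /conj_edge_groupP/edge_groupP[xyF _ _].
  have [yF yo _] := (edge_groupP e y).1 ye.
  split; last by rewrite -{1}(yo : y o = o) dist_aut.
  move: xv; rewrite /singularities /=; apply: contra => xyv.
  have := xyF (x v); rewrite local_action_conj groupMr // groupMr ?groupV //.
  exact: yF.
have := @orbit_count _ _ _ _ _ e v _ K Z code d2 sF F2 xK.
rewrite card_sum !card_prod !card_ord => /(_ _) lt.
apply: leq_trans (lt _) _ => [y z ye By ze Bz yz|].
  by rewrite -(codeP _ (stab y ye By)) yz codeP //; exact: stab.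
rewrite /A -mulnA leq_mul2l mulnDl -!mulnA; apply/orP; right.
by apply: leq_add; rewrite leq_mul2l; apply/orP; right; nia.
Qed.

End Growth.

(** * Asymptotic elements *)

Local Close Scope classical_set_scope.

Theorem theorem4p3 (R : realType) (d : nat) (hd : (2 < d)%N)
    (T : regular_tree d) (c : legal_colouring T)
    (F F' : {group {perm 'I_d}}) (hFF' : F \subset F')
    (hF : [transitive^2 F, on [set: 'I_d] | 'P])
    (e : edge T) (g h : le_boudec c F F')
    (hg : hyperbolic g) (hh : hyperbolic h) :
  asymptotic R g h <->
  exists p q : nat, (0 < p)%N /\ (0 < q)%N /\
    exists M : nat, forall n : nat, (0 < n)%N ->
      (Ne e (g ^- (p * n) * h ^+ (q * n))%g <= M)%N.
Proof.
have fe : finite_set [set origin e; terminus e]%classic.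
  by rewrite finite_setU; split; exact: finite_set1.
have cE : COS (edge_group e : set (le_boudec c F F')).
  by apply: fixator_COS => //; exists (origin e); left.
have [gE _ _] := cE.
have conjE (y z : le_boudec c F F') A :
    conjugate z (conjugate (y^-1 * z)^-1 A) = conjugate y A.
  by rewrite conjugateM invgM invgK mulKVg.
have gcon (y : le_boudec c F F') A : group_closed [in A] -> group_closed [in conjugate y A].
  exact: conjugate_group.
(* (g^(pn), h^(qn)) is translated by h^-(qn) to (x^-1, 1), where x = g^-(pn) h^(qn) *)
split=> [[p [q [p0 [q0 [U [V [cU [cV [M dM]]]]]]]]]|[p [q [p0 [q0 [M NM]]]]]].
  have [gU _ _] := cU; have [gV _ _] := cV.
  have [K1 EV] := COS_index 1 cE cV; have [K2 UE] := COS_index 1 cU cE.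
  rewrite conjugate1 in EV; rewrite conjugate1 in UE.
  pose K := (K1 * (Num.truncn (expR M)).+1 * K2)%N.
  have [D DP] := singularities_bounded e K hd hFF' hF hg hh.
  exists p, q; split=> //; split=> //.
  exists (#|` fset_set (vball c (origin e) D.+1)|)%fset => n _.
  set x := g ^- (p * n) * h ^+ (q * n).
  suff /DP[xo xS] : index_le (edge_group e) (conjugate x^-1 (edge_group e)) K.
    exact: Ne_le_ball.
  have Vx : index_le V (conjugate x^-1 U) (Num.truncn (expR M)).+1.
    have [L1 VU] := COS_index x^-1 cV cU; have [L2 UV] := COS_index x cU cV.
    have := index_le_conj (h ^+ (q * n)) VU; rewrite conjE => VU'.
    have := index_le_conj (g ^+ (p * n)) UV.
    rewrite conjugateM mulKVg => UV'.
    have := COS_dist_index_le (gcon _ _ gU) (gcon _ _ gV) UV' VU' (dM n).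
    move=> /(index_le_conj (h ^+ (q * n))^-1).
    by rewrite !conjugateM mulVg conjugate1 /x invgM invgK.
  apply: index_le_trans (index_le_conj x^-1 UE).
  exact: index_le_trans EV Vx.
exists p, q; split=> //; split=> //; exists (edge_group e), (edge_group e).
split=> //; split=> //.
(* the hypothesis omits n = 0, where the product is 1 *)
pose K := (#|{: {perm 'I_d}}| ^ maxn M (Ne e (1%g : le_boudec c F F')))%N.
have P0 : (0 < #|{: {perm 'I_d}}|)%N by apply/card_gt0P; exists 1.
exists (ln (K ^ 2)%:R) => n; pose x := g ^- (p * n) * h ^+ (q * n).
have xK : (#|{: {perm 'I_d}}| ^ Ne e x <= K)%N.
  rewrite leq_pexp2l // leq_max; case: n @x => [|n] x; last by rewrite NM.
  by rewrite /x !muln0 !expg0 invg1 mulg1 leqnn orbT.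
have [Ex xE] := index_le_hull e x.
apply: COS_dist_le; rewrite ?expn_gt0 ?P0 //; try exact: gcon.
  by have := index_le_conj (h ^+ (q * n)) (index_le_leq xK xE); rewrite conjE.
by have := index_le_conj (h ^+ (q * n)) (index_le_leq xK Ex); rewrite conjE.
Qed.
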